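(* For any root of unity quantum seed $(M,\widetilde B)$ and any $\mathrm{inv}\subseteq[1,N]\setminus\mathrm{ex}$, one has $\mathcal A_\varepsilon(M,\widetilde B,\mathrm{inv})\subseteq\mathcal U_\varepsilon(M,\widetilde B,\mathrm{inv})$.
   Context: Let $\ell$ be a positive integer, $\mathbb Z_\ell=\mathbb Z/\ell\mathbb Z$, $\varepsilon^{1/2}\in\mathbb C$ a primitive $\ell$-th root of unity, $\mathcal A^{1/2}_\varepsilon=\mathbb Z[\varepsilon^{1/2}]$, $\varepsilon^{a/2}=(\varepsilon^{1/2})^a$ for $a\in\mathbb Z_\ell$; $\overline C$ is the reduction mod $\ell$ of an integer matrix $C$; $e_1,\dots,e_N$ is the standard basis of $\mathbb Z^N$. For a skew-symmetric bilinear form $\Lambda:\mathbb Z^N\times\mathbb Z^N\to\mathbb Z_\ell$ with matrix $(\lambda_{ij})$, $\mathcal T_\varepsilon(\Lambda)$ is the $\mathcal A^{1/2}_\varepsilon$-algebra with basis $\{X^f\}_{f\in\mathbb Z^N}$ and $X^fX^g=\varepsilon^{\Lambda(f,g)/2}X^{f+g}$. A root of unity toric frame of a division algebra $\mathcal F$ over $\mathbb Q(\varepsilon^{1/2})$ is a map $M:\mathbb Z^N\to\mathcal F$ such that for some (unique) skew-symmetric $\Lambda=:\Lambda_M$ there is an injective $\mathcal A^{1/2}_\varepsilon$-algebra map $\phi:\mathcal T_\varepsilon(\Lambda)\to\mathcal F$, $\phi(X^f)=M(f)$, with $\mathcal F$ the skew field of fractions of its image. Fix $\mathrm{ex}\subseteq[1,N]$.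 An exchange matrix $\widetilde B=(b_{ij})$ is an integer matrix with rows indexed by $[1,N]$, columns by $\mathrm{ex}$, principal part $B$, $k$-th column $b^k$. $(\Lambda,\widetilde B)$ is $\ell$-compatible if there is $D=\mathrm{diag}(d_j)_{j\in\mathrm{ex}}$, $d_j\in\mathbb Z_{>0}$, with $DB$ skew-symmetric and $\sum_k\overline b_{kj}\lambda_{ki}=\delta_{ij}\overline d_j$ in $\mathbb Z_\ell$ for all $i\in[1,N]$, $j\in\mathrm{ex}$. A root of unity quantum seed is $(M,\widetilde B)$ with $(\Lambda_M,\widetilde B)$ $\ell$-compatible. For $b\in\mathbb Z^N$, $[b]_\pm$ keeps the entries $b_i$ with $\pm b_i\ge0$ and sets the others to $0$. Mutation in direction $k\in\mathrm{ex}$: $\mu_k(\widetilde B)=(b'_{ij})$, $b'_{ij}=-b_{ij}$ if $i=k$ or $j=k$, otherwise $b'_{ij}=b_{ij}+(|b_{ik}|b_{kj}+b_{ik}|b_{kj}|)/2$; $\mu_k(M)$ is the root of unity toric frame with matrix $\overline E^\top\Lambda_M\overline E$ ($E$: $e_{ij}=\delta_{ij}$ for $j\neq k$, $e_{kk}=-1$, $e_{ik}=\max(0,-b_{ik})$ for $i\ne k$) and $\mu_k(M)(e_j)=M(e_j)$ ($j\ne k$), $\mu_k(M)(e_k)=M(-e_k+[b^k]_+)+M(-e_k-[b^k]_-)$. $\mathcal A_\varepsilon(M,\widetilde B,\mathrm{inv})$ is the $\mathcal A^{1/2}_\varepsilon$-subalgebra of $\mathcal F$ generated by all $M'(e_i)$,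 $i\in[1,N]$, over all seeds $(M',\widetilde B')$ mutation-equivalent to $(M,\widetilde B)$, and by $M(e_j)^{-1}$, $j\in\mathrm{inv}$. $\mathcal U_\varepsilon(M,\widetilde B,\mathrm{inv})$ is the intersection over all seeds $(M',\widetilde B')$ mutation-equivalent to $(M,\widetilde B)$ of the subalgebras $\mathcal A^{1/2}_\varepsilon\langle M'(e_i),M'(e_j)^{-1}: i\in[1,N],\ j\in\mathrm{ex}\sqcup\mathrm{inv}\rangle$ of $\mathcal F$. *)

(* Defs.v *)
From HB Require Import structures.
From mathcomp Require Import all_boot all_order all_algebra.
Set Implicit Arguments. Unset Strict Implicit. Unset Printing Implicit Defensive.
Import Order.TTheory GRing.Theory Num.Theory.
Local Open Scope ring_scope.

Section RootOfUnityClusters.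

Variables (F : unitRingType) (q : F) (l : nat) (N : nat).

Definition evec (i : 'I_N) : 'rV[int]_N := \row_j ((j == i)%:Z).

Definition bform (Lam : 'M[int]_N) (f g : 'rV[int]_N) : int :=
  (f *m Lam *m g^T) 0 0.

(* elements of Z[q], the image of A^{1/2}_eps = Z[eps^{1/2}] in F *)
Definition in_Zq (x : F) : Prop :=
  exists (n : nat) (a : 'I_n -> int), x = \sum_(i < n) (a i)%:~R * q ^+ i.

(* elements of the image of phi : T_eps(Lam) -> F, X^f |-> M f *)
Definition in_image (M : 'rV[int]_N -> F) (x : F) : Prop :=
  exists (s : seq 'rV[int]_N) (c : 'rV[int]_N -> F),
    (forall f, in_Zq (c f)) /\ x = \sum_(f <- s) c f * M f.

(* Lam (an integer representative of a Z_l-valued form) is skew-symmetric mod l *)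
Definition skew_mod (Lam : 'M[int]_N) : Prop :=
  forall i j, (Lam i j = - Lam j i %[mod (l%:Z)])%Z.

(* M is a root of unity toric frame with matrix Lam (mod l):
   X^f |-> M f extends to an injective A-algebra map T_eps(Lam) -> F
   and F is the skew field of fractions of the image. *)
Definition toric_frame (M : 'rV[int]_N -> F) (Lam : 'M[int]_N) : Prop :=
  [/\ skew_mod Lam,
      M 0 = 1,
      (forall f g, M f * M g = q ^ (bform Lam f g) * M (f + g)),
      (forall (s : seq 'rV[int]_N) (c : 'rV[int]_N -> F),
          uniq s -> (forall f, in_Zq (c f)) ->
          \sum_(f <- s) c f * M f = 0 -> forall f, f \in s -> c f = 0) &
      (forall x : F, exists a b, [/\ in_image M a, in_image M b, b != 0
                                   & x = a * b^-1])].

Definition is_toric_frame (M : 'rV[int]_N -> F) : Prop :=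
  exists Lam, toric_frame M Lam.

Variable ex : {set 'I_N}.

(* exchange matrices are stored as N x N integer matrices; only the columns
   indexed by ex are meaningful (the other columns are never used). *)

Definition l_compatible (Lam : 'M[int]_N) (B : 'M[int]_N) : Prop :=
  exists d : 'I_N -> int,
    [/\ (forall j, j \in ex -> 0 < d j),
        (forall i j, i \in ex -> j \in ex -> d i * B i j = - (d j * B j i)) &
        (forall i j, j \in ex ->
           (\sum_(k < N) B k j * Lam k i = (i == j)%:Z * d j %[mod (l%:Z)])%Z)].

Definition quantum_seed (M : 'rV[int]_N -> F) (B : 'M[int]_N) : Prop :=
  exists Lam, toric_frame M Lam /\ l_compatible Lam B.

Definition bcol (B : 'M[int]_N) (k : 'I_N) : 'rV[int]_N := \row_i B i k.
Definition vpos (b : 'rV[int]_N) : 'rV[int]_N := map_mx (fun x => Num.max x 0) b.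
Definition vneg (b : 'rV[int]_N) : 'rV[int]_N := map_mx (fun x => Num.min x 0) b.

Definition mutB (k : 'I_N) (B : 'M[int]_N) : 'M[int]_N :=
  \matrix_(i, j)
    if (i == k) || (j == k) then - B i j
    else B i j + ((`|B i k| * B k j + B i k * `|B k j|) %/ 2)%Z.

Definition mutE (k : 'I_N) (B : 'M[int]_N) : 'M[int]_N :=
  \matrix_(i, j)
    if j == k then (if i == k then -1 else Num.max 0 (- B i k))
    else (i == j)%:Z.

Definition mutation (k : 'I_N) (M : 'rV[int]_N -> F) (B : 'M[int]_N)
    (M' : 'rV[int]_N -> F) (B' : 'M[int]_N) : Prop :=
  [/\ k \in ex, B' = mutB k B &
      exists Lam, [/\ toric_frame M Lam,
        toric_frame M' ((mutE k B)^T *m Lam *m mutE k B),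
        (forall j, j != k -> M' (evec j) = M (evec j)) &
        M' (evec k) = M (- evec k + vpos (bcol B k))
                      + M (- evec k - vneg (bcol B k))]].

Inductive mut_equiv (M : 'rV[int]_N -> F) (B : 'M[int]_N) :
    ('rV[int]_N -> F) -> 'M[int]_N -> Prop :=
| mut_equiv_refl : mut_equiv M B M B
| mut_equiv_step k M1 B1 M2 B2 :
    mut_equiv M B M1 B1 -> mutation k M1 B1 M2 B2 -> mut_equiv M B M2 B2.

End RootOfUnityClusters.

(* A^{1/2}_eps-subalgebra of F generated by a set S (A acts through q) *)
Inductive gen_alg (F : unitRingType) (q : F) (S : F -> Prop) : F -> Prop :=
| gen_S x : S x -> gen_alg q S x
| gen_1 : gen_alg q S 1
| gen_q : gen_alg q S q
| gen_opp x : gen_alg q S x -> gen_alg q S (- x)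
| gen_add x y : gen_alg q S x -> gen_alg q S y -> gen_alg q S (x + y)
| gen_mul x y : gen_alg q S x -> gen_alg q S y -> gen_alg q S (x * y).

Definition cluster_alg (F : unitRingType) (q : F) (l N : nat) (ex inv : {set 'I_N})
    (M : 'rV[int]_N -> F) (B : 'M[int]_N) : F -> Prop :=
  gen_alg q (fun x =>
    (exists M' B' i, mut_equiv q l ex M B M' B' /\ x = M' (evec i))
    \/ (exists j, j \in inv /\ x = (M (evec j))^-1)).

Definition upper_cluster_alg (F : unitRingType) (q : F) (l N : nat)
    (ex inv : {set 'I_N}) (M : 'rV[int]_N -> F) (B : 'M[int]_N) : F -> Prop :=
  fun x => forall M' B', mut_equiv q l ex M B M' B' ->
    gen_alg q (fun y =>
      (exists i, y = M' (evec i))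
      \/ (exists j, j \in ex :|: inv /\ y = (M' (evec j))^-1)) x.

(* Main.v *)
Require Import Defs.
From HB Require Import structures.
From mathcomp Require Import all_boot all_order all_algebra.
From mathcomp Require Import boolp classical_sets filter.
From mathcomp Require Import zify ring.
Import Order.TTheory GRing.Theory Num.Theory.
Local Open Scope ring_scope.
Set Implicit Arguments.
Unset Strict Implicit.
Unset Printing Implicit Defensive.

(** Call [(M, B)] generic if some integral functionals are dual to the columns of [B]. For a generic
    seed let [R_r] be the algebra generated by the monomials in which [x_r] has nonnegative exponent
    and, if [r] is exchangeable, by the element exchanged with [x_r]; the upper bound of the seed is
    the intersection of the [R_r]. It contains the cluster variables of the seed and does not grow
    under a mutation [mu_i]: [R_i] is the same for both seeds, and for [r <> i] the algebra [R_r] of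
    the mutated seed lies in the localization of the old [R_r] at a central element [1 + u] built
    from the exchange binomial of [x_i]. This denominator is harmless because for a suitable grading
    [u] has positive degree, so that membership of [x * (1 + u)] in the graded algebra [R_r] can be
    tested on lowest components. Hence cluster variables of generic seeds are Laurent polynomials,
    without frozen variables in the denominators.

    An arbitrary seed is made generic by adjoining one central frozen variable per index (principal
    coefficients, on which the form vanishes). These variables live in an iterated ultrapower of the
    division ring, where the class of the identity sequence is central and transcendental; setting
    them to 1 maps the cluster variables of the generic seed to the given ones. *)

(** * Algebras generated by a frame *)

(** At a root of unity the form is known only modulo $\ell$, so $\ell$-compatibility does not force
    the columns of [B] to be independent; for $\ell=1$ the congruences are empty. Exchange binomials
    in different directions may then share a factor, and the comparison of upper bounds breaks down.
    Independence therefore has to be created by new variables. Since the form vanishes on their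
    coordinates, compatibility is untouched by them.

    The ultrapower replaces the skew field of fractions of $F[y]$: it is a division ring by a
    pointwise argument, without any Ore condition. Characteristic zero enters through transcendence:
    a nonzero polynomial cannot vanish at infinitely many natural numbers.

    Setting the new variables to 1 makes sense only on part of the extension, since denominators may
    vanish there. A mutated variable is defined by a formula with denominators, so its
    specialization is not evident; it exists because the variable is a Laurent polynomial in the
    initial extended seed.

    Membership in the upper cluster algebra is tested one seed at a time, with that seed as the
    base. Mutations are reversible, so all cluster variables can be reached from it. *)

Section GeneratedAlgebra.
Variables (K : unitRingType) (q : K).
Implicit Types S : K -> Prop.

Lemma gen_alg0 S : gen_alg q S 0.
Proof. by rewrite -(subrr 1); apply: gen_add (gen_1 _ _) (gen_opp (gen_1 _ _)). Qed.

Lemma gen_algB S x y : gen_alg q S x -> gen_alg q S y -> gen_alg q S (x - y).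
Proof. by move=> hx hy; apply: gen_add hx (gen_opp hy). Qed.

Lemma gen_algX S x m : gen_alg q S x -> gen_alg q S (x ^+ m).
Proof.
move=> hx; elim: m => [|m IH]; first exact: gen_1.
by rewrite exprS; apply: gen_mul.
Qed.

Lemma gen_alg_sum S (I : eqType) (r : seq I) (E : I -> K) :
  (forall i, i \in r -> gen_alg q S (E i)) -> gen_alg q S (\sum_(i <- r) E i).
Proof.
elim: r => [|i r IH] h; first by rewrite big_nil; apply: gen_alg0.
rewrite big_cons; apply: gen_add; first by apply: h; rewrite mem_head.
by apply: IH => j hj; apply: h; rewrite inE hj orbT.
Qed.

Lemma gen_alg_int S (m : int) : gen_alg q S m%:~R.
Proof.
have hn (a : nat) : gen_alg q S a%:R.
  elim: a => [|a IH]; first exact: gen_alg0.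
  by rewrite -addn1 natrD; apply: gen_add => //; apply: gen_1.
by case: m => a; [apply: hn|rewrite NegzE mulrNz; apply: gen_opp; apply: hn].
Qed.

Lemma gen_alg_sub S S' : (forall x, S x -> gen_alg q S' x) ->
  forall x, gen_alg q S x -> gen_alg q S' x.
Proof.
move=> h x; elim=> {x}.
- exact: h.
- exact: gen_1.
- exact: gen_q.
- by move=> x _; apply: gen_opp.
- by move=> x y _ hx _; apply: gen_add.
- by move=> x y _ hx _; apply: gen_mul.
Qed.

Lemma gen_alg_Zq S x : in_Zq q x -> gen_alg q S x.
Proof.
case=> m [a ->]; apply: (gen_alg_sum (r := index_enum 'I_m)) => i _.
by apply: gen_mul; [apply: gen_alg_int|apply: gen_algX; apply: gen_q].
Qed.

Hypothesis q_central : forall x : K, q * x = x * q.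

(** Elements of $\mathbb Z[q]$ as values of integer polynomials: closure under sums and products
    becomes ring arithmetic of polynomials. *)
Lemma Zq_polyP x : in_Zq q x <-> exists p : {poly int}, x = (map_poly intr p).[q].
Proof.
split=> [[m [a ->]]|[p ->]].
  exists (\sum_(i < m) (a i)%:P * 'X^i).
  rewrite rmorph_sum horner_sum; apply: eq_bigr => i _.
  by rewrite rmorphM /= map_polyC map_polyXn hornerCM hornerXn.
exists (size p), (fun i => p`_i); rewrite (horner_coef_wide _ (size_poly _ _)).
by apply: eq_bigr => i _; rewrite coef_map.
Qed.

Lemma Zq0 : in_Zq q 0.
Proof. by apply/Zq_polyP; exists 0; rewrite rmorph0 horner0. Qed.
Lemma Zq1 : in_Zq q 1.
Proof. by apply/Zq_polyP; exists 1; rewrite rmorph1 hornerC. Qed.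
Lemma Zqq : in_Zq q q.
Proof. by apply/Zq_polyP; exists 'X; rewrite map_polyX hornerX. Qed.
Lemma ZqN x : in_Zq q x -> in_Zq q (- x).
Proof. by move=> /Zq_polyP[p ->]; apply/Zq_polyP; exists (- p); rewrite rmorphN hornerN. Qed.
Lemma ZqD x y : in_Zq q x -> in_Zq q y -> in_Zq q (x + y).
Proof.
move=> /Zq_polyP[p ->] /Zq_polyP[p' ->]; apply/Zq_polyP; exists (p + p').
by rewrite rmorphD hornerD.
Qed.
Lemma ZqM x y : in_Zq q x -> in_Zq q y -> in_Zq q (x * y).
Proof.
move=> /Zq_polyP[p ->] /Zq_polyP[p' ->]; apply/Zq_polyP; exists (p * p').
by rewrite rmorphM hornerM_comm // /comm_poly q_central.
Qed.
Lemma ZqX m : in_Zq q (q ^+ m).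
Proof. by elim: m => [|m IH]; [apply: Zq1|rewrite exprS; apply: ZqM => //; apply: Zqq]. Qed.
Lemma Zq_sum (I : eqType) (r : seq I) (P : pred I) (E : I -> K) :
  (forall i, i \in r -> in_Zq q (E i)) -> in_Zq q (\sum_(i <- r | P i) E i).
Proof.
move=> h; rewrite big_seq_cond; apply: big_ind => //; [exact: Zq0|exact: ZqD|].
by move=> i /andP[hi _]; apply: h.
Qed.

Lemma Zq_central x y : in_Zq q x -> x * y = y * x.
Proof.
case=> m [a ->]; rewrite mulr_suml mulr_sumr; apply: eq_bigr => i _.
rewrite -mulrA.
have -> : q ^+ i * y = y * q ^+ i.
  by apply/esym; apply: commrX; rewrite /GRing.comm q_central.
by rewrite !mulrA mulrzl mulrzr.
Qed.

End GeneratedAlgebra.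

(** * Quantum tori: bicharacters and frames *)

Section Torus.
Variables (K : unitRingType) (q : K) (n : nat).
Hypothesis q_central : forall x : K, q * x = x * q.
Implicit Types (M : 'rV[int]_n -> K) (f g h : 'rV[int]_n) (chi : 'rV[int]_n -> 'rV[int]_n -> K).

(** Stands for $q^{\Lambda(f,g)}$. As $\Lambda$ takes values in $\mathbb Z_\ell$, the powers of [q]
    are recorded instead of the exponents. [chi_skew] only gives [chi f f * chi f f = 1]; the value
    [-1] is possible, which is why [torusN] carries the factor [chi f f]. *)
Record bicharacter chi : Prop := Bicharacter {
  chiDl : forall f g h, chi (f + g) h = chi f h * chi g h;
  chiDr : forall f g h, chi f (g + h) = chi f g * chi f h;
  chi_skew : forall f g, chi f g * chi g f = 1;
  chi_pow : forall f g, exists m : nat, chi f g = q ^+ m }.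

Record torus_law M chi : Prop := TorusLaw {
  law_chi : bicharacter chi;
  law0 : M 0 = 1;
  lawM : forall f g, M f * M g = chi f g * M (f + g) }.

Definition independent M : Prop :=
  forall (s : seq 'rV[int]_n) (c : 'rV[int]_n -> K),
    uniq s -> (forall f, in_Zq q (c f)) ->
    \sum_(f <- s) c f * M f = 0 -> forall f, f \in s -> c f = 0.

Section Bicharacter.
Variable chi : 'rV[int]_n -> 'rV[int]_n -> K.
Hypothesis hchi : bicharacter chi.

Lemma chi_Zq f g : in_Zq q (chi f g).
Proof. by have [m ->] := chi_pow hchi f g; apply: ZqX. Qed.

Lemma chi_central f g x : chi f g * x = x * chi f g.
Proof. exact: Zq_central (chi_Zq f g). Qed.

Lemma chi_unit f g : chi f g \is a GRing.unit.
Proof. by apply/unitrP; exists (chi g f); rewrite !(chi_skew hchi). Qed.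

Lemma chi0l g : chi 0 g = 1.
Proof. by rewrite -[LHS](mulKr (chi_unit 0 g)) -(chiDl hchi) addr0 mulVr ?chi_unit.
Qed.
Lemma chi0r g : chi g 0 = 1.
Proof. by rewrite -[LHS](mulKr (chi_unit g 0)) -(chiDr hchi) addr0 mulVr ?chi_unit. Qed.
Lemma chiV f g : (chi f g)^-1 = chi g f.
Proof. by rewrite -[RHS](mulKr (chi_unit f g)) (chi_skew hchi) mulr1. Qed.
Lemma chiNl f g : chi (- f) g = chi g f.
Proof. by rewrite -[RHS]chiV -[LHS](mulKr (chi_unit f g)) -(chiDl hchi) subrr chi0l mulr1. Qed.
Lemma chiNr f g : chi f (- g) = chi g f.
Proof. by rewrite -[RHS]chiV -[LHS](mulKr (chi_unit f g)) -(chiDr hchi) subrr chi0r mulr1. Qed.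

Lemma chi_mulz f (m : int) g : chi (f *~ m) g = chi f g ^ m.
Proof.
have hn (a : nat) : chi (f *+ a) g = chi f g ^+ a.
  by elim: a => [|a IH]; rewrite ?chi0l // mulrS (chiDl hchi) IH exprS.
case: m => a; first exact: hn.
rewrite NegzE mulrNz chiNl -chiV hn.
by rewrite -[X in _ = X]invr_expz.
Qed.

End Bicharacter.

Section Law.
Variables (M : 'rV[int]_n -> K) (chi : 'rV[int]_n -> 'rV[int]_n -> K).
Hypothesis hM : torus_law M chi.
Let hchi := law_chi hM.

Lemma torus_unit f : M f \is a GRing.unit.
Proof.
apply/unitrP; exists (chi f f * M (- f)); split.
  by rewrite -mulrA (lawM hM) addNr (law0 hM) mulr1 (chiNl hchi) (chi_skew hchi).
by rewrite mulrA -(chi_central hchi) -mulrA (lawM hM) subrr (law0 hM) mulr1 (chiNr hchi)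
  (chi_skew hchi).
Qed.

Lemma torusD f g : M (f + g) = chi g f * (M f * M g).
Proof. by rewrite (lawM hM) mulrA (chi_skew hchi) mul1r. Qed.

Lemma torusN f : M (- f) = chi f f * (M f)^-1.
Proof.
apply: (mulIr (torus_unit f)).
by rewrite mulrVK ?torus_unit // (lawM hM) addNr (law0 hM) mulr1 (chiNl hchi).
Qed.

Lemma torus_comm f g : M f * M g = chi f g * chi f g * (M g * M f).
Proof. by rewrite !(lawM hM) mulrA -[_ * chi g f]mulrA (chi_skew hchi) mulr1 addrC. Qed.

End Law.

Lemma mxzE f (m : int) i : (f *~ m) 0 i = f 0 i * m.
Proof.
case: m => a; first by rewrite mulmxnE -mulr_natr natz.
by rewrite NegzE mulrNz mxE mulmxnE mulrN -mulr_natr natz.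
Qed.

Lemma row_evec f : f = \sum_i evec i *~ f 0 i.
Proof.
apply/rowP => j; rewrite summxE (bigD1 j) //= big1 => [|i ij].
  by rewrite mxzE mxE eqxx mul1r addr0.
by rewrite mxzE mxE eq_sym (negbTE ij) mul0r.
Qed.

(** The supported vectors on which both frames agree form a subgroup, because [torusD] and [torusN]
    compute a frame on sums and opposites from values already known. *)
Lemma torus_ext M M' chi chi' (A : pred 'I_n) :
  torus_law M chi -> torus_law M' chi' ->
  let supported f := forall i, ~~ A i -> f 0 i = 0 in
  (forall f g, supported f -> supported g -> chi f g = chi' f g) ->
  (forall r, A r -> M (evec r) = M' (evec r)) ->
  forall f, supported f -> M f = M' f.
Proof.
move=> hM hM' supported hchi hA f sf.
pose good g := supported g /\ M g = M' g.
have good0 : good 0 by split; [move=> i _; rewrite mxE|rewrite (law0 hM) (law0 hM')].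
have goodD g h : good g -> good h -> good (g + h).
  move=> [sg eg] [sh eh]; split; first by move=> i hi; rewrite mxE sg // sh // addr0.
  by rewrite (torusD hM) (torusD hM') eg eh hchi.
have goodN g : good g -> good (- g).
  move=> [sg eg]; split; first by move=> i hi; rewrite mxE sg // oppr0.
  by rewrite (torusN hM) (torusN hM') eg hchi.
have goodZ g (m : int) : good g -> good (g *~ m).
  move=> gg; have gn (a : nat) : good (g *+ a).
    by elim: a => [//|a IH]; rewrite mulrS; apply: goodD.
  by case: m => a; [apply: gn|rewrite NegzE mulrNz; apply: goodN; apply: gn].
suff [] : good f by [].
rewrite (row_evec f); apply: (big_ind good) => // i _.
case: (boolP (A i)) => hi; last by rewrite sf // mulr0z.
apply: goodZ; split; last exact: hA.
by move=> j hj; rewrite mxE; case: eqP => // e; rewrite e hi in hj.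
Qed.

End Torus.

(** * Spans of monomials and uniqueness of expansions *)

Section Span.
Variables (K : unitRingType) (q : K) (n : nat).
Hypothesis q_central : forall x : K, q * x = x * q.
Variables (M : 'rV[int]_n -> K).
Implicit Types (f g : 'rV[int]_n) (P Q : pred 'rV[int]_n).

(** Exponents may repeat in the list, so that a sum of expansions is a concatenation; [tspan_group]
    collects equal exponents when independence is applied. *)
Definition tspan P (x : K) : Prop :=
  exists t : seq (K * 'rV[int]_n),
    (forall p, p \in t -> in_Zq q p.1 /\ P p.2) /\ x = \sum_(p <- t) p.1 * M p.2.

Lemma tspan0 P : tspan P 0.
Proof. by exists [::]; split => //; rewrite big_nil. Qed.

Lemma tspanD P x y : tspan P x -> tspan P y -> tspan P (x + y).
Proof.
move=> [t [ht ->]] [u [hu ->]]; exists (t ++ u); split; last by rewrite big_cat.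
by move=> p; rewrite mem_cat => /orP[/ht|/hu].
Qed.

Lemma tspan_gen P f : P f -> tspan P (M f).
Proof.
move=> hf; exists [:: (1, f)]; split; last by rewrite big_seq1 mul1r.
by move=> p; rewrite inE => /eqP -> /=; split => //; apply: Zq1.
Qed.

Lemma tspanZ P c x : in_Zq q c -> tspan P x -> tspan P (c * x).
Proof.
move=> hc [t [ht ->]]; exists [seq (c * p.1, p.2) | p <- t]; split.
  by move=> _ /mapP[p /ht[h1 h2] ->] /=; split => //; apply: ZqM.
by rewrite big_map mulr_sumr; apply: eq_bigr => p _ /=; rewrite mulrA.
Qed.

Lemma tspanN P x : tspan P x -> tspan P (- x).
Proof. by move=> h; rewrite -mulN1r; apply: tspanZ => //; apply: ZqN; apply: Zq1. Qed.

Lemma tspanB P x y : tspan P x -> tspan P y -> tspan P (x - y).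
Proof. by move=> hx hy; apply: tspanD => //; apply: tspanN. Qed.

Lemma tspan_sum P (I : eqType) (r : seq I) (A : pred I) (E : I -> K) :
  (forall i, i \in r -> A i -> tspan P (E i)) -> tspan P (\sum_(i <- r | A i) E i).
Proof.
move=> h; rewrite big_seq_cond; apply: big_ind => //; [exact: tspan0|exact: tspanD|].
by move=> i /andP[]; apply: h.
Qed.

Lemma tspan_ind P (T : K -> Prop) :
  T 0 -> (forall x y, T x -> T y -> T (x + y)) ->
  (forall c f, in_Zq q c -> P f -> T (c * M f)) -> forall x, tspan P x -> T x.
Proof.
move=> T0 TD TM x [t [ht ->]]; rewrite big_seq_cond; apply: big_ind => //.
by move=> p /andP[/ht[h1 h2] _]; apply: TM.
Qed.

Lemma tspan_sub P Q x : (forall f, P f -> Q f) -> tspan P x -> tspan Q x.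
Proof. by move=> h [t [ht ->]]; exists t; split => // p /ht[? /h]. Qed.

Lemma tspan_split P Q x : tspan P x -> exists y z,
  [/\ tspan (predI P Q) y, tspan (predI P (predC Q)) z & x = y + z].
Proof.
case=> t [ht ->]; rewrite (bigID (fun p => Q p.2)) /=.
exists (\sum_(p <- t | Q p.2) p.1 * M p.2), (\sum_(p <- t | ~~ Q p.2) p.1 * M p.2); split => //.
  apply: tspan_sum => p /ht[h1 h2] h3; apply: tspanZ => //; apply: tspan_gen.
  by rewrite /= h2.
apply: tspan_sum => p /ht[h1 h2] h3; apply: tspanZ => //; apply: tspan_gen.
by rewrite /= h2.
Qed.

Lemma tspan_group (t : seq (K * 'rV[int]_n)) :
  \sum_(p <- t) p.1 * M p.2 =
  \sum_(f <- undup [seq p.2 | p <- t]) (\sum_(p <- t | p.2 == f) p.1) * M f.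
Proof.
under [RHS]eq_bigr do rewrite mulr_suml.
rewrite (exchange_big_dep xpredT) //= big_seq [RHS]big_seq; apply: eq_bigr => p hp.
rewrite big_mkcond (bigD1_seq p.2) ?undup_uniq ?mem_undup ?map_f //= eqxx.
by rewrite big1 ?addr0 // => f; rewrite eq_sym => /negbTE ->.
Qed.

Hypothesis indM : independent q M.

Lemma tspan_sum0 (t : seq (K * 'rV[int]_n)) f :
  (forall p, p \in t -> in_Zq q p.1) -> \sum_(p <- t) p.1 * M p.2 = 0 ->
  \sum_(p <- t | p.2 == f) p.1 = 0.
Proof.
move=> ht h0.
pose c g := \sum_(p <- t | p.2 == g) p.1.
pose s := undup [seq p.2 | p <- t].
case: (boolP (f \in s)) => fs; last first.
  rewrite big_seq_cond big1 // => p /andP[hp /eqP e]; move/negP: fs; case.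
  by rewrite mem_undup -e map_f.
apply: (indM (s := s) (c := c)) => //; first exact: undup_uniq.
  by move=> g; apply: Zq_sum.
by rewrite -[RHS]h0 tspan_group.
Qed.

(** Subtracting the two expansions of [x] gives a relation in which an exponent satisfying [P]
    receives contributions from the first expansion only; by independence its coefficient
    vanishes. *)
Lemma tspan_disjoint P Q x : (forall f, P f -> ~~ Q f) -> tspan P x -> tspan Q x -> x = 0.
Proof.
move=> dPQ [t [ht ->]] [u [hu e]].
pose v := t ++ [seq (- p.1, p.2) | p <- u].
have hv p : p \in v -> in_Zq q p.1.
  rewrite mem_cat => /orP[/ht[]//|/mapP[p' /hu[h _] ->]] /=; exact: ZqN.
have v0 : \sum_(p <- v) p.1 * M p.2 = 0.
  rewrite big_cat big_map /= e.
  by under [X in _ + X]eq_bigr do rewrite mulNr; rewrite sumrN subrr.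
have tE f : P f -> \sum_(p <- t | p.2 == f) p.1 = 0.
  move=> Pf; rewrite -[LHS]addr0 -[RHS](tspan_sum0 f hv v0) big_cat big_map /=.
  congr (_ + _); apply/esym.
  rewrite big_seq_cond big1 // => p /andP[/hu[_ hQ] /eqP ef].
  by move: (dPQ f Pf); rewrite -ef hQ.
rewrite tspan_group.
rewrite big_seq big1 // => f; rewrite mem_undup => /mapP[p /ht[_ hP] ->].
by rewrite tE // mul0r.
Qed.

Variable chi : 'rV[int]_n -> 'rV[int]_n -> K.
Hypothesis hM : torus_law q M chi.

Lemma tspanM P Q (S : pred 'rV[int]_n) x y : (forall f g, P f -> Q g -> S (f + g)) ->
  tspan P x -> tspan Q y -> tspan S (x * y).
Proof.
move=> hS hx hy; move: x hx; apply: tspan_ind => [|x x' h h'|c f hc hf].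
- by rewrite mul0r; apply: tspan0.
- by rewrite mulrDl; apply: tspanD.
move: y hy; apply: tspan_ind => [|x x' h h'|c' g hc' hg].
- by rewrite mulr0; apply: tspan0.
- by rewrite mulrDr; apply: tspanD.
have -> : c * M f * (c' * M g) = c * c' * chi f g * M (f + g).
  rewrite -!mulrA; congr (_ * _); rewrite !mulrA -(Zq_central q_central _ hc').
  by rewrite -mulrA (lawM hM) mulrA.
apply: tspanZ; last by apply: tspan_gen; apply: hS.
by apply: ZqM => //; [apply: ZqM|apply: chi_Zq (law_chi hM) _ _].
Qed.

End Span.

(** * Gradings *)

Lemma additive_map0 n (phi : 'rV[int]_n -> int) :
  (forall f g, phi (f + g) = phi f + phi g) -> phi 0 = 0.
Proof. by move=> phiD; apply: (addrI (phi 0)); rewrite -phiD !addr0. Qed.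

Section Homogeneous.
Variables (K : unitRingType) (q : K) (n : nat).
Hypothesis q_central : forall x : K, q * x = x * q.
Variables (M : 'rV[int]_n -> K) (chi : 'rV[int]_n -> 'rV[int]_n -> K).
Hypothesis hM : torus_law q M chi.
Hypothesis indM : independent q M.
Variable phi : 'rV[int]_n -> int.
Hypothesis phiD : forall f g, phi (f + g) = phi f + phi g.

Let phi0 := additive_map0 phiD.

Lemma tspan_bounded x : tspan q M predT x ->
  exists lo (m : nat), tspan q M (fun f => (lo <= phi f) && (phi f < lo + m%:Z)) x.
Proof.
move=> [t [ht ->]].
pose N := (\sum_(p <- t) `|phi p.2|%N)%N.
have hN p : p \in t -> (`|phi p.2| <= N)%N.
  by move=> hp; rewrite /N (big_rem p) //= leq_addr.
exists (- N%:Z), (N + N).+1, t; split => // p hp; split; first by case: (ht p hp).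
by have := hN p hp; lia.
Qed.

Section Graded.
Variable S : K -> Prop.
Hypothesis homS : forall x, S x -> exists a, tspan q M (fun f => phi f == a) x.
Let R := gen_alg q S.

Lemma gen_alg_graded x : R x -> exists t : seq (int * K),
  (forall p, p \in t -> R p.2 /\ tspan q M (fun f => phi f == p.1) p.2) /\
  x = \sum_(p <- t) p.2.
Proof.
have hom1 a y : R y -> tspan q M (fun f => phi f == a) y -> exists t : seq (int * K),
    (forall p, p \in t -> R p.2 /\ tspan q M (fun f => phi f == p.1) p.2) /\
    y = \sum_(p <- t) p.2.
  move=> Ry hy; exists [:: (a, y)]; rewrite big_seq1; split => // p.
  by rewrite inE => /eqP ->.
elim=> {x} [x Sx|||x Rx [t [ht ->]]|x y Rx [t [ht ->]] Ry [u [hu ->]]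
           |x y Rx [t [ht ->]] Ry [u [hu ->]]].
- by have [a ha] := homS Sx; apply: hom1 ha; apply: gen_S.
- by apply: (hom1 0); [apply: gen_1|rewrite -(law0 hM); apply: tspan_gen; rewrite phi0].
- apply: (hom1 0); first exact: gen_q.
  suff : tspan q M (fun f => phi f == 0) (q * M 0) by rewrite (law0 hM) mulr1.
  apply: (tspanZ q_central (Zqq q)).
  by apply: tspan_gen; rewrite phi0.
- exists [seq (p.1, - p.2) | p <- t]; split; last by rewrite big_map /= sumrN.
  move=> _ /mapP[p /ht[h1 h2] ->]; split; first exact: gen_opp.
  exact: tspanN.
- exists (t ++ u); split; last by rewrite big_cat.
  by move=> p; rewrite mem_cat => /orP[/ht|/hu].
- exists [seq (p.1 + p'.1, p.2 * p'.2) | p <- t, p' <- u]; split.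
    move=> _ /allpairsP[[p p'] /= [/ht[h1 h2] /hu[h3 h4] ->]]; split; first exact: gen_mul.
    apply: (tspanM q_central hM _ h2 h4) => f g /eqP <- /eqP <-.
    by rewrite phiD.
  by rewrite big_allpairs_dep /= big_distrlr.
Qed.

(** Homogeneous generators make [R] a graded subalgebra: [y + z] is a sum of homogeneous elements of
    [R], and uniqueness of expansions identifies [y] with the part of degree [a] of that sum. *)
Lemma graded_part a y z : tspan q M (fun f => phi f == a) y ->
  tspan q M (fun f => phi f != a) z -> R (y + z) -> R y.
Proof.
move=> hy hz /gen_alg_graded[t [ht e]].
suff -> : y = \sum_(p <- t | p.1 == a) p.2.
  rewrite -big_filter; apply: gen_alg_sum => p.
  by rewrite mem_filter => /andP[_ /ht[]].
apply/eqP; rewrite -subr_eq0; apply/eqP.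
apply: (tspan_disjoint indM (P := fun f => phi f == a) (Q := fun f => phi f != a)).
- by move=> f ->.
- apply: tspanB => //; apply: tspan_sum => // p /ht[_ +] /eqP <-.
  by apply: tspan_sub => f.
have -> : y - \sum_(p <- t | p.1 == a) p.2 = \sum_(p <- t | p.1 != a) p.2 - z.
  apply/eqP; rewrite subr_eq addrAC -subr_eq opprK; apply/eqP.
  by rewrite e (bigID (fun p => p.1 == a)) /= addrC.
apply: tspanB => //; apply: tspan_sum => // p /ht[_ +] pa.
by apply: tspan_sub => f /eqP ->.
Qed.

(* The lowest component of [x * (1 + u)] is the lowest component of [x]. *)
Lemma graded_cancel u x : tspan q M (fun f => 0 < phi f) u ->
  (forall y, R y -> R (y * u)) -> tspan q M predT x -> R (x * (1 + u)) -> R x.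
Proof.
move=> hu Ru /tspan_bounded[lo [m]].
(* Induction on the number of degrees that [x] may occupy; splitting off the lowest component [y]
   shortens the range by one. *)
elim: m lo x => [|m IH] lo x hx.
  move=> _; suff -> : x = 0 by apply: gen_alg0.
  apply: (tspan_disjoint indM _ hx hx) => f.
  by lia.
have [y [z [hy hz ->]]] := tspan_split q_central (fun f => phi f == lo) hx.
have {}hy : tspan q M (fun f => phi f == lo) y.
  by apply: tspan_sub hy => f /andP[].
have {}hz : tspan q M (fun f => (lo + 1 <= phi f) && (phi f < lo + 1 + m%:Z)) z.
  by apply: tspan_sub hz => f; rewrite /= ; lia.
move=> hR.
have Ry : R y.
  apply: (graded_part (z := z + (y + z) * u) hy); last by move: hR; rewrite mulrDr mulr1 addrA.
  apply: tspanD; first by apply: tspan_sub hz => f; lia.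
  rewrite mulrDl; apply: tspanD.
    apply: (tspanM q_central hM _ hy hu) => f g /eqP hf hg.
    by rewrite phiD hf; lia.
  by apply: (tspanM q_central hM _ hz hu) => f g hf hg; rewrite phiD; lia.
apply: gen_add => //; apply: IH hz _.
have -> : z * (1 + u) = (y + z) * (1 + u) - (y + y * u).
  by rewrite mulrDl [y * (1 + u)]mulrDr mulr1 [_ + z * _]addrC addrK.
by apply: gen_algB => //; apply: gen_add => //; apply: Ru.
Qed.

End Graded.

End Homogeneous.

(** * Integer powers of a root of unity *)

Section Roots.
Variables (K : unitRingType) (q : K) (l : nat).
Hypotheses (l_gt0 : (0 < l)%N) (ql : q ^+ l = 1).

Lemma root_unit : q \is a GRing.unit.
Proof.
apply/unitrP; exists (q ^+ l.-1); rewrite -exprS -exprSr prednK //.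
Qed.

Lemma root_exprz (m : int) : exists2 a : nat, (a < l)%N & q ^ m = q ^+ a.
Proof.
have e := divz_eq m l%:Z.
have h1 : 0 <= (m %% l%:Z)%Z by apply: modz_ge0; lia.
have h2 : (m %% l%:Z)%Z < l%:Z by apply: ltz_pmod; lia.
exists `|(m %% l%:Z)%Z|%N; first by lia.
rewrite {1}e exprzDr ?root_unit // mulrC -exprz_exp [q ^ l]ql exp1rz mul1r.
by rewrite -[in LHS](gez0_abs h1).
Qed.

Lemma Zq_exprz (m : int) : (forall x : K, q * x = x * q) -> in_Zq q (q ^ m).
Proof. by move=> hq; have [a _ ->] := root_exprz m; apply: ZqX. Qed.

End Roots.

(** * Mutation of frames *)

Lemma max0_sub (x : int) : Num.max x 0 = Num.max (- x) 0 + x.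
Proof. by rewrite !maxEle; case: ifP => h1; case: ifP => h2; lia. Qed.

Section Emap.
Variables (n : nat) (k : 'I_n).
Implicit Types (b f g : 'rV[int]_n).

(** The matrix [mutE] acting on exponent vectors, as [mulmx_mutE] shows. The column [b] is a free
    argument, so that [Emap k (- b)] is the matrix for the opposite choice of sign. *)
Definition Emap b f : 'rV[int]_n :=
  \row_i if i == k then - f 0 k else f 0 i + f 0 k * Num.max 0 (- b 0 i).

Lemma EmapD b f g : Emap b (f + g) = Emap b f + Emap b g.
Proof. by apply/rowP => i; rewrite !mxE; case: eqP => _; ring. Qed.

Lemma Emap_k b f : Emap b f 0 k = - f 0 k.
Proof. by rewrite mxE eqxx. Qed.

Lemma Emap_id b f : f 0 k = 0 -> Emap b f = f.
Proof.
by move=> fk; apply/rowP => i; rewrite !mxE fk oppr0 mul0r addr0; case: eqP => // ->.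
Qed.

Lemma Emap_inj b : injective (Emap b).
Proof.
move=> f g e; have ek : f 0 k = g 0 k by apply: oppr_inj; rewrite -!(Emap_k b) e.
apply/rowP => i; have := congr1 (fun h : 'rV_n => h 0 i) e.
by rewrite !mxE ek; case: eqP => [-> //|_ /addIr].
Qed.

Lemma EmapN b f : b 0 k = 0 -> Emap (- b) f = Emap b f + b *~ f 0 k.
Proof.
move=> bk; apply/rowP => i; rewrite [RHS]mxE mxzE !mxE.
case: eqP => [->|_]; first by rewrite bk; ring.
have -> : Num.max 0 (- - b 0 i) = Num.max 0 (- b 0 i) + b 0 i.
  by rewrite opprK ![Num.max 0 _]maxC max0_sub.
ring.
Qed.

Lemma Emap_evec b : b 0 k = 0 -> Emap b (evec k) = vpos (- b) - evec k.
Proof.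
move=> bk; apply/rowP => i; rewrite !mxE eqxx.
case: eqP => [->|_]; first by rewrite bk oppr0 maxxx; ring.
by rewrite mul1r add0r subr0 maxC.
Qed.

Lemma vposB b : vpos b = vpos (- b) + b.
Proof. by apply/rowP => i; rewrite !mxE max0_sub. Qed.

End Emap.

Section Mutation.
Variables (K : unitRingType) (q : K) (l n : nat) (k : 'I_n).
Hypothesis q_central : forall x : K, q * x = x * q.
Hypotheses (l_gt0 : (0 < l)%N) (ql : q ^+ l = 1).
Variables (M : 'rV[int]_n -> K) (chi : 'rV[int]_n -> 'rV[int]_n -> K).
Hypothesis hM : torus_law q M chi.
Let hchi := law_chi hM.
Implicit Types (f g h : 'rV[int]_n).
Let q_unit := root_unit l_gt0 ql.
Let qD := exprzDr q_unit.
Let qz_central (m : int) x : q ^ m * x = x * q ^ m.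
Proof. exact: (Zq_central q_central _ (Zq_exprz l_gt0 ql m q_central)). Qed.

(* With [w = q ^ d], [mut_prod b d m] is the normalized product of the factors
   [1 + w ^ (1 - 2 * j) * M b] for [0 < j <= m]; for [m < 0] it is the inverse of the product
   over [m < j <= 0]. The cocycle identity [mut_prod_cocycle] makes [mut_frame] a frame. *)
Definition mut_factor (b : 'rV[int]_n) (d m : int) : K := 1 + q ^ (d * (1 - 2 * m)) * M b.

Fixpoint mut_prod_pos b d (a : nat) : K :=
  if a is a'.+1 then mut_factor b d a * mut_prod_pos b d a' else 1.
Fixpoint mut_prod_neg b d (a : nat) : K :=
  if a is a'.+1 then (mut_factor b d (- a'%:Z))^-1 * mut_prod_neg b d a' else 1.
Definition mut_prod b d (m : int) : K :=
  match m with Posz a => mut_prod_pos b d a | Negz a => mut_prod_neg b d a.+1 end.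

(** A monomial change of variables corrected by a factor in [M b]. For generic $q$ the correction is
    conjugation by a quantum dilogarithm in [M b]; at a root of unity the explicit products take its
    place. *)
Definition mut_frame b d (f : 'rV[int]_n) : K := M (Emap k b f) * mut_prod b d (f 0 k).

Definition mut_chi b (f g : 'rV[int]_n) : K := chi (Emap k b f) (Emap k b g).

Lemma mut_chi_bichar b : bicharacter q (mut_chi b).
Proof.
split=> [f g h|f g h|f g|f g]; rewrite /mut_chi ?EmapD.
- exact: (chiDl hchi).
- exact: (chiDr hchi).
- exact: (chi_skew hchi).
- exact: (chi_pow hchi).
Qed.

Section OneSign.
Variables (b : 'rV[int]_n) (d : int).
Hypothesis b_k : b 0 k = 0.
Hypothesis chib : forall g, chi b g = q ^ (d * g 0 k).

Lemma chibr g : chi g b = q ^ (- (d * g 0 k)).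
Proof. by rewrite -(chiV hchi) chib invr_expz. Qed.

(** [M b] and [M (Emap k b g)] commute up to the square of [q ^ (- d * g 0 k)]; this square accounts
    for the 2 in the exponent [d * (1 - 2 * m)], and the commutation becomes a shift of the
    index. *)
Lemma mut_factor_shift m g :
  mut_factor b d m * M (Emap k b g) = M (Emap k b g) * mut_factor b d (m + g 0 k).
Proof.
rewrite /mut_factor [LHS]mulrDl [RHS]mulrDr mul1r mulr1; congr (_ + _).
rewrite -mulrA (torus_comm hM) chib Emap_k -qD mulrA -qD.
rewrite [RHS]mulrA -qz_central -[RHS]mulrA; congr (q ^ _ * _); ring.
Qed.

Hypothesis unit_factor : forall m, mut_factor b d m \is a GRing.unit.

Lemma mut_prodS m : mut_prod b d (m + 1) = mut_factor b d (m + 1) * mut_prod b d m.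
Proof.
case: m => a.
  by rewrite -PoszD addn1.
have -> : Negz a + 1 = - a%:Z by rewrite NegzE; lia.
rewrite /= mulrA divrr // mul1r.
by case: a => [|a]; rewrite ?oppr0 // -NegzE.
Qed.

Lemma mut_prod_cocycle m m' (g : 'rV[int]_n) : m' = g 0 k ->
  mut_prod b d m * M (Emap k b g) * mut_prod b d m' = M (Emap k b g) * mut_prod b d (m + m').
Proof.
(* Passing from [a] to [a + 1] multiplies both sides on the left by the same unit. The equivalence
   serves the induction upwards and downwards. *)
move=> e; have step a :
    mut_prod b d (a + 1) * M (Emap k b g) * mut_prod b d m' = M (Emap k b g) * mut_prod b d
      (a + 1 + m') <->
    mut_prod b d a * M (Emap k b g) * mut_prod b d m' = M (Emap k b g) * mut_prod b d (a + m').
  have -> : a + 1 + m' = a + m' + 1 by ring.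
  rewrite !mut_prodS -!mulrA.
  have -> : a + m' + 1 = a + 1 + g 0 k by rewrite e; ring.
  rewrite (mulrA (M _) (mut_factor _ _ _)) -mut_factor_shift -!mulrA.
  by split=> [/(mulrI (unit_factor _))|->].
elim: m => [|a IH|a IH].
- by rewrite mul1r add0r.
- by rewrite -addn1 PoszD; apply/step.
- by apply/step; have -> : - a.+1%:Z + 1 = - a%:Z by lia.
Qed.

Lemma mut_frame_law : torus_law q (mut_frame b d) (mut_chi b).
Proof.
split; first exact: mut_chi_bichar.
  by rewrite /mut_frame mxE Emap_id ?mxE // (law0 hM) mulr1.
move=> f g; rewrite /mut_frame.
rewrite -mulrA (mulrA (mut_prod _ _ _)) (mut_prod_cocycle _ (erefl _)).
by rewrite mulrA (lawM hM) -EmapD -mulrA mxE.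
Qed.

Lemma mut_frame_id (f : 'rV[int]_n) : f 0 k = 0 -> mut_frame b d f = M f.
Proof. by move=> fk; rewrite /mut_frame fk mulr1 Emap_id. Qed.

(** The right factor does not depend on [h]: all two-term sums in direction [k] agree up to a
    monomial on the left. *)
Lemma binomial_factor (h : 'rV[int]_n) : h 0 k = -1 -> M h + M (h + b) = M h * mut_factor b d 1.
Proof.
move=> hk; rewrite /mut_factor [RHS]mulrDr mulr1; congr (_ + _).
rewrite [RHS]mulrA -qz_central -mulrA (lawM hM) chibr mulrA -qD hk.
rewrite -[LHS]mul1r -[1 in LHS](expr0z q); congr (q ^ _ * _); ring.
Qed.

Lemma mut_frame_k : mut_frame b d (evec k) = M (vpos b - evec k) + M (vpos (- b) - evec k).
Proof.
have ek : evec k 0 k = 1 by rewrite mxE eqxx.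
rewrite /mut_frame ek /= mulr1 Emap_evec // -binomial_factor; last first.
  by rewrite !mxE eqxx b_k oppr0 maxxx.
by rewrite addrC; congr (M _ + _); rewrite [vpos b]vposB; apply/rowP => i; rewrite !mxE; ring.
Qed.

(** The product is 1 plus a combination of powers of [M b]. The predicate [D] covers two uses:
    positive degree for a grading, and positive exponent of a given variable. *)
Lemma mut_prod_pos_span (D : pred 'rV[int]_n) a : D b -> (forall f, D f -> D (b + f)) ->
  tspan q M D (mut_prod_pos b d a - 1).
Proof.
move=> Db DS; elim: a => [|a IH] /=; first by rewrite subrr; apply: tspan0.
have -> : mut_factor b d a.+1 * mut_prod_pos b d a - 1 =
   (mut_prod_pos b d a - 1) + q ^ (d * (1 - 2 * a.+1%:Z)) * (M b + M b * (mut_prod_pos b d a - 1)).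
  have -> : M b + M b * (mut_prod_pos b d a - 1) = M b * mut_prod_pos b d a.
    by rewrite mulrBr mulr1 addrC subrK.
  by rewrite /mut_factor [X in X - 1]mulrDl mul1r -mulrA addrAC.
apply: tspanD => //; apply: (tspanZ q_central (Zq_exprz l_gt0 ql _ q_central)).
apply: tspanD; first exact: tspan_gen.
apply: (tspanM (P := pred1 b) q_central hM _ _ IH); last by apply: tspan_gen; rewrite /= eqxx.
by move=> f g /eqP ->; apply: DS.
Qed.

Hypothesis indM : independent q M.
Variable phi : 'rV[int]_n -> int.
Hypotheses (phiD : forall f g, phi (f + g) = phi f + phi g) (phib : 0 < phi b).

Lemma seq_argmin (T : eqType) (s : seq T) (v : T -> int) x :
  x \in s -> exists2 y, y \in s & forall z, z \in s -> v y <= v z.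
Proof.
elim: s x => [//|a s IH] x _.
case: s IH => [|a' s] IH; first by exists a; rewrite ?mem_head // => z; rewrite inE => /eqP ->.
have [y ys hy] := IH a' (mem_head _ _).
case: (lerP (v a) (v y)) => h.
  exists a; first exact: mem_head.
  by move=> z; rewrite inE => /orP[/eqP -> //|/hy]; apply: le_trans.
exists y; first by rewrite inE ys orbT.
by move=> z; rewrite inE => /orP[/eqP ->|/hy //]; apply: ltW.
Qed.

(** In lowest degree for [phi] the new frame is [M] composed with the injective map [Emap k b],
    because the correction factors start with 1. A relation for the new frame thus yields one for
    [M]. *)
Lemma mut_frame_indep : independent q (mut_frame b d).
Proof.
move=> s c us hc s0 f fs; apply/eqP/negP => /negP cf.
have hM' := mut_frame_law.
(* Multiplying the relation on the right by the new frame at [g] makes every [k]-th coordinate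
   nonnegative, so that no inverse factor remains in any [mut_prod]. *)
pose A := (\sum_(f <- s) `|(f 0 k)%R|)%N.
have hA g : g \in s -> (`|(g 0 k)%R| <= A)%N by move=> hg; rewrite /A (big_rem g) //= leq_addr.
clearbody A.
pose g := evec k *~ A%:Z.
have gk : g 0 k = A%:Z by rewrite mxzE mxE eqxx mul1r.
pose s' := [seq f <- s | c f != 0].
have fs' : f \in s' by rewrite mem_filter cf.
have [f0 f0s hf0] := seq_argmin (fun f => phi (Emap k b (f + g))) fs'.
pose a := phi (Emap k b (f0 + g)).
pose c' f := c f * mut_chi b f g.
have hc' f' : in_Zq q (c' f').
  by apply: ZqM => //; apply: chi_Zq (mut_chi_bichar b) _ _.
have e0 : \sum_(f <- s') c' f * mut_frame b d (f + g) = 0.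
  rewrite big_filter -[RHS](mul0r (mut_frame b d g)) -[X in _ = X * _]s0 mulr_suml.
  rewrite big_mkcond; apply: eq_bigr => f' _.
  rewrite -mulrA (lawM hM') mulrA -/(c' f').
  by case: eqP => //= e; rewrite /c' e !mul0r.
(* The terms of minimal degree [a]. All other contributions, including the nonconstant parts of the
   products, have larger degree, so these terms alone sum to zero. *)
pose t := [seq (c' f, Emap k b (f + g)) | f <- [seq f <- s' | phi (Emap k b (f + g)) == a]].
have t0 : \sum_(p <- t) p.1 * M p.2 = 0.
  apply: (tspan_disjoint indM (P := fun f => phi f == a) (Q := fun f => a < phi f)).
  - by move=> h /eqP ->; rewrite ltxx.
  - rewrite big_map; apply: tspan_sum => f'; rewrite mem_filter => /andP[h _] _ /=.
    by apply: tspanZ => //; apply: tspan_gen.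
  have -> : \sum_(p <- t) p.1 * M p.2 =
     - (\sum_(f <- s' | phi (Emap k b (f + g)) != a) c' f * M (Emap k b (f + g)) +
        \sum_(f <- s') c' f * (M (Emap k b (f + g)) * (mut_prod b d ((f + g) 0 k) - 1))).
    have e1 : \sum_(f <- s') c' f * M (Emap k b (f + g)) = \sum_(p <- t) p.1 * M p.2 +
        \sum_(f <- s' | phi (Emap k b (f + g)) != a) c' f * M (Emap k b (f + g)).
      by rewrite (bigID (fun f => phi (Emap k b (f + g)) == a)) /= big_map big_filter.
    apply/eqP; rewrite -addr_eq0 addrA -e1 -big_split /= -[X in _ == X]e0; apply/eqP.
    apply: eq_bigr => f' _; rewrite /mut_frame.
    by rewrite -mulrDr mulrBr mulr1 addrC subrK.
  apply: tspanN => //; apply: tspanD.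
    apply: tspan_sum => f' /hf0 h1 h2; apply: tspanZ => //; apply: tspan_gen.
    by rewrite lt_neqAle eq_sym h2.
  apply: tspan_sum => f' hf' _; apply: tspanZ => //.
  have -> : (f' + g) 0 k = Posz `|((f' + g) 0 k)%R|%N.
    have hf's : f' \in s by move: hf'; rewrite mem_filter => /andP[].
    have h1 := hA _ hf's; rewrite mxE gk; move: (f' 0 k) h1 => z h1; lia.
  apply: (tspanM (P := fun f => f == Emap k b (f' + g)) (Q := fun f => 0 < phi f) q_central hM).
  - by move=> h h' /eqP -> hh'; rewrite phiD; have := hf0 f' hf'; rewrite /a; lia.
  - by apply: tspan_gen.
  apply: mut_prod_pos_span => // h hh; rewrite phiD; lia.
have := tspan_sum0 indM (t := t) (Emap k b (f0 + g)) _ t0.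
have f0s2 : f0 \in [seq f <- s' | phi (Emap k b (f + g)) == a] by rewrite mem_filter f0s eqxx.
have us2 : uniq [seq f <- s' | phi (Emap k b (f + g)) == a] by rewrite !filter_uniq.
rewrite big_map big_mkcond (bigD1_seq f0) //= eqxx big1 => [|f' hf']; last first.
  by case: eqP => // /Emap_inj /addIr e; rewrite e eqxx in hf'.
rewrite addr0 => h.
have : c' f0 = 0 by apply: h => p /mapP[f' _ ->]; apply: hc'.
move=> /(congr1 (fun x => x * mut_chi b g f0)).
rewrite /c' -mulrA (chi_skew (mut_chi_bichar b)) mulr1 mul0r => e.
by move: f0s; rewrite mem_filter e eqxx.
Qed.

End OneSign.

Section Signs.
Variables (b : 'rV[int]_n) (d : int).
Hypothesis b_k : b 0 k = 0.
Hypothesis chib : forall g, chi b g = q ^ (d * g 0 k).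

Lemma chiNb g : chi (- b) g = q ^ (- d * g 0 k).
Proof. by rewrite (chiNl hchi) (chibr chib) mulNr. Qed.

Lemma mut_chiN f g : mut_chi (- b) f g = mut_chi b f g.
Proof.
have bb : chi b b = 1 by rewrite chib b_k mulr0.
have bN m h h' : chi h (b *~ m) = q ^ (- (d * h 0 k * m)) by
  rewrite -(chiV hchi) (chi_mulz hchi) chib exprz_exp invr_expz.
rewrite /mut_chi !EmapN //
  (chiDl hchi) !(chiDr hchi) !(chi_mulz hchi) !chib !bN // !exprz_exp -!mulrA -!qD.
rewrite !Emap_k.
rewrite -[RHS]mulr1; congr (_ * _); rewrite -[RHS](expr0z q); congr (q ^ _).
rewrite mxzE b_k; ring.
Qed.

Hypothesis unit_factor : forall m, mut_factor b d m \is a GRing.unit.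
Hypothesis unit_factorN : forall m, mut_factor (- b) (- d) m \is a GRing.unit.

(** Both sides are frames with the same form, and the exchange binomial is symmetric in the sign of
    [b]. This leaves the sign free, to be chosen later so that [M (- b)] or [M b] has no negative
    power of a given variable. *)
Lemma mut_frameN f : mut_frame (- b) (- d) f = mut_frame b d f.
Proof.
have bNk : (- b) 0 k = 0 by rewrite mxE b_k oppr0.
have hbN := chiNb.
refine (torus_ext q_central (mut_frame_law bNk hbN unit_factorN)
   (mut_frame_law b_k chib unit_factor)
   (A := predT) _ _ _) => // [f' g _ _|r _].
  exact: mut_chiN.
have [->|rk] := eqVneq r k.
  by rewrite !mut_frame_k // opprK addrC.
by rewrite !mut_frame_id // mxE eq_sym (negbTE rk).
Qed.

End Signs.

(** [M'] is any frame satisfying the exchange relation, not necessarily [mut_frame], so that the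
    lemma also applies to the toric frames of the given seeds. *)
Lemma mutation_involutive (b : 'rV[int]_n) (d : int) (M' : 'rV[int]_n -> K) :
  b 0 k = 0 -> (forall g, chi b g = q ^ (d * g 0 k)) ->
  torus_law q M' (mut_chi b) ->
  (forall r, r != k -> M' (evec r) = M (evec r)) ->
  M' (evec k) = M (vpos b - evec k) + M (vpos (- b) - evec k) ->
  M (evec k) = M' (vpos b - evec k) + M' (vpos (- b) - evec k).
Proof.
move=> b_k chib hM' hr hk.
have hid f : f 0 k = 0 -> M' f = M f.
  move=> fk; apply: (torus_ext q_central hM' hM (A := fun i => i != k)) => //.
    move=> g h hg hh; rewrite /mut_chi !Emap_id //; [apply: hh|apply: hg]; by rewrite eqxx.
  by move=> i /negPn /eqP ->.
have hchi' := law_chi hM'.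
(* After this multiplication both sides are combinations of [M (vpos b)] and [M (vpos (- b))], and
   only the coefficients have to be matched; [hv0] and [hv1] do this. *)
apply: (mulIr (torus_unit q_central hM' (evec k))).
have vk : (vpos b) 0 k = 0 by rewrite !mxE b_k maxxx.
have vNk : (vpos (- b)) 0 k = 0 by rewrite !mxE b_k oppr0 maxxx.
pose h := vpos (- b) - evec k.
have hE : Emap k b (evec k) = h by rewrite Emap_evec.
have h2 : vpos b - evec k = h + b by rewrite vposB /h addrAC.
have hk1 : h 0 k = -1 by rewrite mxE [X in _ + X]mxE vNk mxE eqxx.
have hh : chi h h * chi h h = 1 by rewrite (chi_skew hchi).
have ebh : chi (evec k) b = chi b h.
  by rewrite -(chiV hchi) !chib invr_expz hk1 mxE eqxx mulr1 mulrN1.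
have chiE (v : 'rV[int]_n) : v 0 k = 0 -> mut_chi b (v - evec k) (evec k) = chi v h * chi h h.
  by move=> v0; rewrite (chiDl hchi') (chiNl hchi') /mut_chi hE Emap_id.
have hv0 : chi (vpos (- b)) h * chi h h = chi (evec k) h.
  have -> : vpos (- b) = h + evec k by rewrite subrK.
  by rewrite (chiDl hchi) -mulrA (chi_central q_central hchi) -mulrA hh mulr1.
have hv1 : chi (vpos b) h * chi h h = chi (evec k) h * chi b h.
  by rewrite vposB (chiDl hchi) -mulrA (chi_central q_central hchi b h) mulrA hv0.
rewrite mulrDl !(lawM hM') !subrK !chiE // (hid (vpos b)) // (hid (vpos (- b))) // hv0 hv1.
by rewrite hk mulrDr !(lawM hM) !(addrC (evec k)) !subrK h2 (chiDr hchi) ebh.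
Qed.

End Mutation.

(** * Mutation of exchange matrices *)

(** For a fixed sign of [y] the numerator is [y] times the sum or difference of [|x|] and [x], which
    is twice a positive or negative part; hence the division by 2 is exact. *)
Lemma mutB_entry (x y : int) : ((`|x| * y + x * `|y|) %/ 2)%Z =
  if 0 <= y then y * Num.max 0 x else y * Num.max 0 (- x).
Proof.
have h2 (z : int) : ((z * 2) %/ 2)%Z = z by rewrite mulzK.
case: (lerP 0 y) => hy; case: (lerP 0 x) => hx.
- by rewrite !ger0_norm // -(h2 (y * _)); congr (_ %/ _)%Z; ring.
- by rewrite (ltr0_norm hx) (ger0_norm hy) mulr0 -[RHS](h2 0); congr (_ %/ _)%Z; ring.
- by rewrite (ltr0_norm hy) (ger0_norm hx) max_l ?oppr_le0 // mulr0 -[RHS](h2 0);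
  congr (_ %/ _)%Z; ring.
- rewrite (ltr0_norm hy) (ltr0_norm hx) max_r ?oppr_ge0 1?ltW //.
  by rewrite -(h2 (y * _)); congr (_ %/ _)%Z; ring.
Qed.

Section ExchangeMatrix.
Variables (n : nat) (k : 'I_n) (B : 'M[int]_n).

Lemma bcol_mutB_k : bcol (mutB k B) k = - bcol B k.
Proof. by apply/rowP => i; rewrite !mxE eqxx orbT. Qed.

Lemma mutB_k j : mutB k B k j = - B k j.
Proof. by rewrite mxE eqxx. Qed.

Lemma mutB_involutive : mutB k (mutB k B) = B.
Proof.
apply/matrixP => i j; rewrite !mxE !eqxx orbT /=.
case: eqP => [_|_] /=; first by rewrite opprK.
case: eqP => [_|_] /=; first by rewrite opprK.
rewrite !mutB_entry !opprK -addrA -[RHS]addr0; congr (_ + _).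
case: (ltrgt0P (B k j)) => h; last by rewrite h oppr0 lexx !mul0r addr0.
  by rewrite oppr_ge0 leNgt h /=; ring.
by rewrite oppr_ge0 ltW //; ring.
Qed.

Hypothesis Bkk : B k k = 0.

(** The factorization $\mu_k(\widetilde B)=E\widetilde BF$ read column by column, with the
    involution $E$ moved to the left side and $F$ the elementary matrix with the entries
    $\max(0,b_{kj})$ in row $k$. *)
Lemma Emap_bcol_mutB j : j != k ->
  Emap k (bcol B k) (bcol (mutB k B) j) = bcol B j + bcol B k *~ Num.max 0 (B k j).
Proof.
move=> jk; apply/rowP => i; rewrite [RHS]mxE mxzE !mxE eqxx (negbTE jk) /=.
case: eqP => [->|_] /=; first by rewrite Bkk; ring.
rewrite mutB_entry.
have h0 : Num.max 0 (B i k) = Num.max 0 (- B i k) + B i k.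
  by rewrite ![Num.max 0 _]maxC max0_sub.
by case: (lerP 0 (B k j)) => h; rewrite ?h0; ring.
Qed.

End ExchangeMatrix.

Section Compatible.
Variables (K : unitRingType) (q : K) (n : nat) (ex : {set 'I_n}).
Record compatible (chi : 'rV[int]_n -> 'rV[int]_n -> K) (B : 'M[int]_n) (d : 'I_n -> int) : Prop :=
 Compatible {
  compat_pos : forall j, j \in ex -> 0 < d j;
  compat_skew : forall i j, i \in ex -> j \in ex -> d i * B i j = - (d j * B j i);
  compat_chi : forall j g, j \in ex -> chi (bcol B j) g = q ^ (d j * g 0 j) }.

(* Plays the role of full rank: it makes distinct exchange binomials coprime. *)
Definition dual_basis (B : 'M[int]_n) : Prop :=
  exists phi : 'I_n -> 'rV[int]_n -> int,
    (forall i f g, phi i (f + g) = phi i f + phi i g) /\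
    (forall i j, i \in ex -> j \in ex -> phi i (bcol B j) = (i == j)%:Z).

Section Mutate.
Variables (chi : 'rV[int]_n -> 'rV[int]_n -> K) (B : 'M[int]_n) (d : 'I_n -> int).
Hypothesis hB : compatible chi B d.

Lemma compat_diag j : j \in ex -> B j j = 0.
Proof. move=> jex; have := compat_skew hB jex jex; have := compat_pos hB jex; nia. Qed.

Lemma compat_sign i j : i \in ex -> j \in ex ->
  [/\ (0 < B i j) = (B j i < 0), (B i j < 0) = (0 < B j i) & (B i j == 0) = (B j i == 0)].
Proof.
move=> iex jex; have := compat_skew hB iex jex.
have := compat_pos hB iex; have := compat_pos hB jex.
move: (d i) (d j) (B i j) (B j i) => x y u v hx hy e.
split; apply/idP/idP; nia.
Qed.

Variable k : 'I_n.
Hypotheses (hchi : bicharacter q chi) (kex : k \in ex).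

(** $E$ carries the mutated columns to the columns of $\widetilde BF$ with $F$ unimodular, so the
    new functionals are the old ones composed with $E$ and corrected by $F^{-1}$. The correction
    only affects the functional of index [k]. *)
Lemma dual_basis_mutB : dual_basis B -> dual_basis (mutB k B).
Proof.
case=> phi [phiD phiB].
have phi0 i : phi i 0 = 0 by apply: additive_map0.
have phiz i f (m : int) : phi i (f *~ m) = phi i f * m.
  have hn (a : nat) : phi i (f *+ a) = phi i f * a%:Z.
    by elim: a => [|a IH]; rewrite ?phi0 ?mulr0 // mulrS phiD IH -(addn1 a) PoszD; ring.
  case: m => a; first exact: hn.
  rewrite NegzE mulrNz; have := phiD i (f *+ a.+1) (- (f *+ a.+1)).
  by rewrite subrr phi0 hn mulrN => /eqP; rewrite eq_sym addrC addr_eq0 => /eqP.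
have phiN i f : phi i (- f) = - phi i f by rewrite -mulrN1z phiz mulrN1.
pose b := bcol B k.
pose psi (i : 'I_n) (f : 'rV[int]_n) := if i == k then
   \sum_(j in ex | j != k) Num.max 0 (B k j) * phi j (Emap k b f) - phi k (Emap k b f)
  else phi i (Emap k b f).
have Ek : Emap k b (bcol (mutB k B) k) = - b.
  by rewrite bcol_mutB_k Emap_id // !mxE compat_diag // oppr0.
exists psi; split => [i f g|i j iex jex]; rewrite /psi.
  case: ifP => _; rewrite EmapD phiD //.
  rewrite opprD addrACA -big_split /=; congr (_ + _).
  by apply: eq_bigr => j _; rewrite phiD mulrDr.
have [->|jk] := eqVneq j k.
  rewrite Ek; case: (eqVneq i k) => [_|ik]; last first.
    by rewrite phiN phiB // (negbTE ik) oppr0.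
  rewrite big1 => [|j' /andP[j'ex /negbTE j'k]]; last by rewrite phiN phiB // j'k oppr0 mulr0.
  by rewrite phiN phiB // eqxx sub0r opprK.
rewrite Emap_bcol_mutB ?compat_diag //.
have E i' : i' \in ex -> phi i' (bcol B j + bcol B k *~ Num.max 0 (B k j)) =
    (i' == j)%:Z + (i' == k)%:Z * Num.max 0 (B k j).
  by move=> hi; rewrite phiD phiz !phiB.
case: (eqVneq i k) => [->|ik]; last first.
  by rewrite E // (negbTE ik) mul0r addr0.
rewrite eq_sym (negbTE jk)
  (bigD1 j) ?jex //= big1 => [|j' /andP[/andP[j'ex /negbTE j'k] /negbTE j'j]].
  by rewrite !E // !eqxx (eq_sym k) (negbTE jk); lia.
by rewrite E // j'j j'k mul0r addr0 mulr0.
Qed.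

Variable l : nat.
Hypotheses (l_gt0 : (0 < l)%N) (ql : q ^+ l = 1).

Lemma compatible_mutB : compatible (mut_chi k chi (bcol B k)) (mutB k B) d.
Proof.
have q_unit := root_unit l_gt0 ql.
split; first exact: compat_pos hB.
  move=> i j iex jex; rewrite !mxE.
  have hij := compat_skew hB iex jex.
  rewrite orbC; case: ifP => _; first by rewrite !mulrN hij.
  rewrite !mutB_entry.
  have hkj := compat_skew hB kex jex; have hki := compat_skew hB kex iex.
  (* Both products equal $-d_kb_{ki}b_{kj}$. The entries of column [k] are next expressed by the
     signs in row [k], which reduces skew-symmetry of the correction term to this identity. *)
  have key : d i * (B k j * B i k) = d j * (B k i * B j k).
    rewrite mulrCA (mulrCA (d j)); have -> : d i * B i k = - (d k * B k i) by rewrite hki opprK.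
    have -> : d j * B j k = - (d k * B k j) by rewrite hkj opprK.
    ring.
  have [kj1 kj2 kj3] := compat_sign kex jex; have [ki1 ki2 ki3] := compat_sign kex iex.
  have -> : Num.max 0 (B i k) = if 0 <= B k i then 0 else B i k.
    by rewrite maxEle; case: ifP => h; case: ifP => h'; lia.
  have -> : Num.max 0 (- B i k) = if 0 <= B k i then - B i k else 0.
    by rewrite maxEle; case: ifP => h; case: ifP => h'; lia.
  have -> : Num.max 0 (B j k) = if 0 <= B k j then 0 else B j k.
    by rewrite maxEle; case: ifP => h; case: ifP => h'; lia.
  have -> : Num.max 0 (- B j k) = if 0 <= B k j then - B j k else 0.
    by rewrite maxEle; case: ifP => h; case: ifP => h'; lia.
  by case: ifP => _; case: ifP => _; rewrite !mulrDr hij ?mulrN ?mulr0 ?addr0 ?key ?opprD ?opprK.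
move=> j g jex; rewrite /mut_chi.
have [->|jk] := eqVneq j k.
  rewrite bcol_mutB_k (@Emap_id _ k _ (- bcol B k)) ?mxE ?compat_diag ?oppr0 //.
  rewrite (chiNl hchi) -(chiV hchi) (compat_chi hB) // invr_expz Emap_k; congr (q ^ _); ring.
rewrite Emap_bcol_mutB ?compat_diag // (chiDl hchi) (chi_mulz hchi) !(compat_chi hB) //.
rewrite exprz_exp -exprzDr // Emap_k mxE (negbTE jk) mxE; congr (q ^ _).
have hkj := compat_skew hB kex jex.
have -> : d k * - g 0 k * Num.max 0 (B k j) = - g 0 k * (d k * Num.max 0 (B k j)) by ring.
(* Skew-symmetry of [DB], applied to positive parts; it turns the factor [d k] into the factor [d j]
   required for column [j]. *)
have -> : d k * Num.max 0 (B k j) = d j * Num.max 0 (- B j k).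
  rewrite !maxr_pMr ?ltW ?(compat_pos hB) //.
  by rewrite !mulr0 hkj mulrN.
ring.
Qed.

End Mutate.
End Compatible.

(** * Upper bounds *)

Section UpperBound.
Variables (K : unitRingType) (q : K) (l n : nat) (ex : {set 'I_n}).
Hypothesis q_central : forall x : K, q * x = x * q.
Hypotheses (l_gt0 : (0 < l)%N) (ql : q ^+ l = 1).
Hypothesis K_div : forall x : K, x != 0 -> x \is a GRing.unit.
Implicit Types (f g h : 'rV[int]_n) (B : 'M[int]_n) (d : 'I_n -> int).

Definition exchange_elt (M : 'rV[int]_n -> K) B (r : 'I_n) : K :=
  M (vpos (bcol B r) - evec r) + M (vpos (- bcol B r) - evec r).

Definition local_gen M B (r : 'I_n) (y : K) : Prop :=
  (exists2 f : 'rV[int]_n, 0 <= f 0 r & y = M f) \/ (r \in ex /\ y = exchange_elt M B r).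

Definition local_alg M B r := gen_alg q (local_gen M B r).

Definition upper_bound M B (x : K) : Prop := forall r, local_alg M B r x.

Record generic_seed M (chi : 'rV[int]_n -> 'rV[int]_n -> K) B d : Prop := GenericSeed {
  gs_law : torus_law q M chi;
  gs_indep : independent q M;
  gs_compat : compatible q ex chi B d;
  gs_dual : dual_basis ex B }.

Section LocalAlgebra.
Variables (M : 'rV[int]_n -> K) (chi : 'rV[int]_n -> 'rV[int]_n -> K) (B : 'M[int]_n).
Variable (d : 'I_n -> int).
Hypothesis hM : torus_law q M chi.
Hypothesis hB : compatible q ex chi B d.
Let hchi := law_chi hM.

Lemma local_alg_torus r x : local_alg M B r x -> tspan q M predT x.
Proof.
have gen f : tspan q M predT (M f) by apply: tspan_gen.
elim=> {x} [x [[f _ ->]|[_ ->]]|||x _ IH|x y _ hx _ hy|x y _ hx _ hy].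
- exact: gen.
- exact: tspanD.
- by rewrite -(law0 hM).
- suff : tspan q M predT (q * M 0) by rewrite (law0 hM) mulr1.
  exact: tspanZ (Zqq q) (gen 0).
- exact: tspanN.
- exact: tspanD.
- exact: (tspanM q_central hM (P := predT) (Q := predT)).
Qed.

Lemma local_alg_span r x : tspan q M (fun f => 0 <= f 0 r) x -> local_alg M B r x.
Proof.
apply: tspan_ind; [exact: gen_alg0|by move=> *; apply: gen_add|].
move=> c f hc hf; apply: gen_mul; first exact: gen_alg_Zq.
by apply: gen_S; left; exists f.
Qed.

(** By [binomial_factor] the two sums share their right factor. The monomial between them has
    exponent 0 in $x_r$, so one sum belongs to an algebra of type $R_r$ as soon as the other
    does. *)
Lemma binomial_transfer r h h1 : r \in ex -> h 0 r = -1 -> h1 0 r = -1 ->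
  M h1 + M (h1 + bcol B r) = chi h (h1 - h) * (M (h1 - h) * (M h + M (h + bcol B r))).
Proof.
move=> rex hr h1r.
have hb g := compat_chi hB g rex.
rewrite (binomial_factor q_central l_gt0 ql hM hb h1r)
  (binomial_factor q_central l_gt0 ql hM hb hr).
rewrite -[in LHS](subrK h h1) (torusD hM (h1 - h) h) -!mulrA.
by [].
Qed.

Lemma exchange_eltE r : exchange_elt M B r =
  M (vpos (- bcol B r) - evec r) + M (vpos (- bcol B r) - evec r + bcol B r).
Proof. by rewrite /exchange_elt [vpos (bcol B r)]vposB addrC addrAC. Qed.

Lemma vposN_evec r : B r r = 0 -> (vpos (- bcol B r) - evec r) 0 r = -1.
Proof. by move=> h; rewrite !mxE h oppr0 maxxx eqxx. Qed.

Lemma local_alg_binomial r h : r \in ex -> h 0 r = -1 -> local_alg M B r (M h + M (h + bcol B r)).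
Proof.
move=> rex hr; have Brr := compat_diag hB rex.
rewrite (@binomial_transfer r (vpos (- bcol B r) - evec r)) ?vposN_evec //.
apply: gen_mul; first by apply: gen_alg_Zq; apply: (chi_Zq q_central hchi).
apply: gen_mul; last by rewrite -exchange_eltE; apply: gen_S; right.
by apply: gen_S; left; exists (h - (vpos (- bcol B r) - evec r)) => //;
  rewrite mxE hr [X in _ + X]mxE vposN_evec.
Qed.

(** The term 1 has degree 0 and cannot be cancelled by terms of positive degree, so the sum is
    nonzero in a division ring. *)
Lemma one_plus_unit (phi : 'rV[int]_n -> int) u : independent q M ->
  (forall f g, phi (f + g) = phi f + phi g) ->
  tspan q M (fun f => 0 < phi f) u -> 1 + u \is a GRing.unit.
Proof.
move=> indM phiD hu; apply: K_div; apply/negP => /eqP e.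
have phi0 := additive_map0 phiD.
have /eqP := oner_neq0 K; apply.
apply: (tspan_disjoint indM (P := fun f => phi f == 0) (Q := fun f => 0 < phi f)).
- by move=> f /eqP ->.
- by rewrite -(law0 hM); apply: tspan_gen; rewrite phi0.
- have -> : 1 = - u by apply/eqP; rewrite -addr_eq0 e.
  exact: tspanN.
Qed.

Lemma one_plus_unitN (phi : 'rV[int]_n -> int) u : independent q M ->
  (forall f g, phi (f + g) = phi f + phi g) ->
  tspan q M (fun f => phi f < 0) u -> 1 + u \is a GRing.unit.
Proof.
move=> indM phiD hu; apply: (@one_plus_unit (fun f => - phi f)) => //.
  by move=> f g; rewrite phiD opprD.
by apply: tspan_sub hu => f; rewrite oppr_gt0.
Qed.

End LocalAlgebra.

(** * Localization at the central element *)

Section Localization.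
Variables (M : 'rV[int]_n -> K) (chi : 'rV[int]_n -> 'rV[int]_n -> K) (B : 'M[int]_n).
Variables (d : 'I_n -> int) (r : 'I_n).
Hypothesis hM : torus_law q M chi.
Hypothesis indM : independent q M.
Hypothesis hB : compatible q ex chi B d.
Let hchi := law_chi hM.
Variables (i : 'I_n) (c : 'rV[int]_n) (dc : int).
Hypothesis chic : forall g, chi c g = q ^ (dc * g 0 i).
Hypothesis c_r : 0 <= c 0 r.
Variable phi : 'rV[int]_n -> int.
Hypothesis phiD : forall f g, phi (f + g) = phi f + phi g.
Hypothesis phic : 0 < phi c.
Hypothesis phi_r : r \in ex -> phi (bcol B r) = 0.
Let R := local_alg M B r.

(* [M c] commutes with each [M f] up to an [l]-th root of unity, so [(M c) ^+ l] is central;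
   each [1 + z * M c] with [z ^+ l = 1] divides this element. *)
Definition center_elt : K := 1 - (- M c) ^+ l.

Let u := - (- M c) ^+ l.
Let Mc_R : R (M c).
Proof. by apply: gen_S; left; exists c. Qed.

Let u_R : R u.
Proof. by apply: gen_opp; apply: gen_algX; apply: gen_opp. Qed.

Let phi_u : tspan q M (fun f => 0 < phi f) u.
Proof.
apply: tspanN => //; rewrite -(prednK l_gt0).
elim: l.-1 => [|m IH]; first by rewrite expr1; apply: tspanN => //; apply: tspan_gen.
rewrite exprS; apply: (tspanM q_central hM _ _ IH (P := fun f => 0 < phi f)).
  by move=> f g hf hg; rewrite phiD addr_gt0.
by apply: tspanN => //; apply: tspan_gen.
Qed.

Lemma center_unit : center_elt \is a GRing.unit.
Proof. exact: (one_plus_unit hM indM phiD phi_u). Qed.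

Lemma center_local : R center_elt.
Proof. by apply: gen_add; [apply: gen_1|]. Qed.

Lemma center_central x : tspan q M predT x -> center_elt * x = x * center_elt.
Proof.
apply: (tspan_ind (T := fun x => center_elt * x = x * center_elt)) => [|y z hy hz|a f ha _].
- by rewrite mulr0 mul0r.
- by rewrite [LHS]mulrDr [RHS]mulrDl hy hz.
have hcomm : (- M c) ^+ l * M f = M f * (- M c) ^+ l.
  pose w := chi c f * chi c f.
  have hw m z : w ^+ m * z = z * w ^+ m.
    apply/esym; apply: commrX; rewrite /GRing.comm; apply/esym.
    by apply: (Zq_central q_central); apply: ZqM => //; apply: (chi_Zq q_central hchi).
  have step m : (- M c) ^+ m * M f = w ^+ m * (M f * (- M c) ^+ m).
    elim: m => [|m IH]; first by rewrite !expr0 !mul1r mulr1.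
    have -> : (- M c) ^+ m.+1 * M f = - M c * ((- M c) ^+ m * M f) by rewrite exprS mulrA.
    rewrite IH [LHS]mulrA -hw -[LHS]mulrA [w ^+ m.+1]exprSr -[RHS]mulrA; congr (_ * _).
    rewrite (exprS (- M c)) [LHS]mulrA mulNr (torus_comm hM) -/w.
    by rewrite !mulrA mulrN.
  rewrite step /w; have [a' ->] := chi_pow hchi c f.
  by rewrite -exprD -exprM mulnC exprM ql expr1n mul1r.
rewrite mulrA -(Zq_central q_central _ ha) -!mulrA; congr (_ * _).
by rewrite mulrBl mulrBr mul1r mulr1 hcomm.
Qed.

Definition localized (x : K) : Prop := exists m, R (x * center_elt ^+ m).

Lemma center_commX m x : tspan q M predT x -> center_elt ^+ m * x = x * center_elt ^+ m.
Proof.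
move=> hx; apply/esym; apply: commrX; rewrite /GRing.comm; apply/esym.
exact: center_central.
Qed.

(** [x] itself need not lie in the torus, where centrality is known; a multiple
    [x * center_elt ^+ a] does, and the unit can be cancelled. *)
Lemma localized_comm m x : localized x -> center_elt ^+ m * x = x * center_elt ^+ m.
Proof.
case=> a /(local_alg_torus hM) h.
have uZ : center_elt ^+ a \is a GRing.unit by apply: unitrX; apply: center_unit.
have := center_commX m h; rewrite mulrA -[x * _ * _]mulrA -exprD addnC exprD mulrA.
by move=> /(mulIr uZ).
Qed.

Lemma localized_local x : R x -> localized x.
Proof. by move=> h; exists 0%N; rewrite expr0 mulr1. Qed.

Lemma localizedM x y : localized x -> localized y -> localized (x * y).
Proof.
move=> [a ha] hy; have [b hb] := hy; exists (a + b)%N.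
have -> : x * y * center_elt ^+ (a + b) = x * center_elt ^+ a * (y * center_elt ^+ b).
  by rewrite exprD !mulrA -(mulrA x) -(localized_comm a hy) !mulrA.
exact: gen_mul.
Qed.

Lemma localizedD x y : localized x -> localized y -> localized (x + y).
Proof.
have centerX m : R (center_elt ^+ m) by apply: gen_algX; apply: center_local.
move=> [a ha] [b hb]; exists (a + b)%N; rewrite mulrDl.
apply: gen_add; first by rewrite exprD mulrA; apply: gen_mul => //; apply: centerX.
by rewrite addnC exprD mulrA; apply: gen_mul => //; apply: centerX.
Qed.

Lemma localized_gen S : (forall y, S y -> localized y) -> forall y, gen_alg q S y -> localized y.
Proof.
move=> hS y; elim=> {y} [y /hS //|||y _ [a ha]|y z _ hy _ hz|y z _ hy _ hz].
- exact/localized_local/gen_1.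
- exact/localized_local/gen_q.
- by exists a; rewrite mulNr; apply: gen_opp.
- exact: localizedD.
- exact: localizedM.
Qed.

(** By [phi_r] the two terms of the exchange binomial of [r] have the same degree, so all generators
    of [R] are homogeneous. Then [graded_cancel] removes one power of [center_elt] at a time. *)
Lemma localized_cancel x : tspan q M predT x -> localized x -> R x.
Proof.
move=> hx [m]; elim: m => [|m IH]; first by rewrite expr0 mulr1.
rewrite exprSr mulrA => h; apply: IH; move: h.
have hxm : tspan q M predT (x * center_elt ^+ m).
  apply: (tspanM q_central hM (P := predT) (Q := predT)) => //.
  by apply: (local_alg_torus hM (r := r) (B := B)); apply: gen_algX; apply: center_local.
apply: (graded_cancel q_central hM indM phiD _ phi_u) => //; last first.
  by move=> y hy; apply: gen_mul.
move=> y [[f _ ->]|[rex ->]]; first by exists (phi f); apply: tspan_gen.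
have Brr := compat_diag hB rex.
rewrite exchange_eltE //; exists (phi (vpos (- bcol B r) - evec r)).
by apply: tspanD; apply: tspan_gen => //; rewrite phiD phi_r // addr0.
Qed.

Lemma mut_factor_localV m : localized (mut_factor q M c dc m)^-1.
Proof.
rewrite /mut_factor; have [a _ ->] := root_exprz l_gt0 ql (dc * (1 - 2 * m)).
pose Y := - (q ^+ a * M c).
have hY : (- M c) ^+ l = Y ^+ l.
  rewrite /Y -mulrN exprMn_comm; last by apply: (Zq_central q_central); apply: ZqX.
  by rewrite -exprM mulnC exprM ql expr1n mul1r.
(* Geometric sum: [Y ^+ l] does not depend on the root of unity in [Y], and the cofactor of [1 - Y]
   is a polynomial in [Y], hence in [R]. *)
have e : center_elt = (1 - Y) * \sum_(j < l) Y ^+ j.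
  by rewrite /center_elt hY -opprB subrX1 -mulNr opprB.
have e1 : 1 + q ^+ a * M c = 1 - Y by rewrite /Y opprK.
have hu1 : 1 - Y \is a GRing.unit.
  rewrite -e1; apply: (one_plus_unit hM indM phiD).
  by apply: tspanZ; [|apply: ZqX|apply: tspan_gen].
exists 1%N; rewrite expr1 e1 e mulKr //.
apply: (gen_alg_sum (r := index_enum 'I_l)) => j _.
apply: gen_algX; apply: gen_opp; apply: gen_mul => //.
by apply: gen_algX; apply: gen_q.
Qed.

Lemma mut_factor_local m : R (mut_factor q M c dc m).
Proof.
rewrite /mut_factor; apply: gen_add; first exact: gen_1.
by apply: gen_mul => //; apply: gen_alg_Zq; apply: (Zq_exprz l_gt0 ql).
Qed.

Lemma mut_prod_localized m : localized (mut_prod q M c dc m).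
Proof.
have h1 : localized 1 by exact/localized_local/gen_1.
case: m => a /=.
  elim: a => [|a IH] //=; apply: localizedM => //.
  exact/localized_local/mut_factor_local.
apply: localizedM; first exact: mut_factor_localV.
elim: a => [|a IH] //=; apply: localizedM => //; exact: mut_factor_localV.
Qed.

End Localization.
End UpperBound.

(** * Mutation of upper bounds *)

Section Step.
Variables (K : unitRingType) (q : K) (l n : nat) (ex : {set 'I_n}).
Hypothesis q_central : forall x : K, q * x = x * q.
Hypotheses (l_gt0 : (0 < l)%N) (ql : q ^+ l = 1).
Hypothesis K_div : forall x : K, x != 0 -> x \is a GRing.unit.
Variables (M : 'rV[int]_n -> K) (chi : 'rV[int]_n -> 'rV[int]_n -> K) (B : 'M[int]_n).
Variables (d : 'I_n -> int) (i : 'I_n).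
Hypothesis iex : i \in ex.
Hypothesis hS : generic_seed q ex M chi B d.
Let hM := gs_law hS.
Let indM := gs_indep hS.
Let hB := gs_compat hS.
Let hchi := law_chi hM.
Let b := bcol B i.
Implicit Types (f g h : 'rV[int]_n).

Definition mut_seed := mut_frame q i M b (d i).
Let M' := mut_seed.
Let B' := mutB i B.
Let chi' := mut_chi i chi b.

Let b_i : b 0 i = 0. Proof. by rewrite mxE (compat_diag hB). Qed.
Let chib g : chi b g = q ^ (d i * g 0 i). Proof. exact: (compat_chi hB _ iex). Qed.

Lemma dual_phi : exists phi : 'rV[int]_n -> int, [/\ forall f g, phi (f + g) = phi f + phi g,
  phi b = 1 & forall j, j \in ex -> j != i -> phi (bcol B j) = 0].
Proof.
have [phi [phiD phiB]] := gs_dual hS; exists (phi i); split => //.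
  by rewrite phiB // eqxx.
by move=> j jex ji; rewrite phiB // eq_sym (negbTE ji).
Qed.

Lemma mut_factor_unit m : mut_factor q M b (d i) m \is a GRing.unit.
Proof.
have [phi [phiD phib _]] := dual_phi.
apply: (one_plus_unit q_central K_div hM indM phiD); apply: tspanZ => //;
  first exact: (Zq_exprz l_gt0 ql).
by apply: tspan_gen; rewrite phib.
Qed.

Lemma mut_factor_unitN m : mut_factor q M (- b) (- d i) m \is a GRing.unit.
Proof.
have [phi [phiD phib _]] := dual_phi.
apply: (one_plus_unitN q_central K_div hM indM phiD); apply: tspanZ => //;
  first exact: (Zq_exprz l_gt0 ql).
apply: tspan_gen; have := phiD b (- b); rewrite subrr (additive_map0 phiD) phib; lia.
Qed.

Lemma mut_seed_generic : generic_seed q ex M' chi' B' d.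
Proof.
split.
- exact: (mut_frame_law q_central l_gt0 ql hM b_i chib mut_factor_unit).
- have [phi [phiD phib _]] := dual_phi.
  apply: (mut_frame_indep q_central l_gt0 ql hM b_i chib mut_factor_unit indM phiD).
  by rewrite phib.
- exact: (compatible_mutB hB hchi iex l_gt0 ql).
- exact: (dual_basis_mutB hB iex (gs_dual hS)).
Qed.

Let hM' := gs_law mut_seed_generic.
Let hB' := gs_compat mut_seed_generic.

Lemma mut_seed_i : M' (evec i) = exchange_elt M B i.
Proof. exact: (mut_frame_k q_central l_gt0 ql hM b_i chib). Qed.

Lemma mut_seed_id f : f 0 i = 0 -> M' f = M f.
Proof. exact: mut_frame_id. Qed.

Lemma exchange_mut_seed : exchange_elt M' B' i = M (evec i).
Proof.
rewrite /exchange_elt /B' bcol_mutB_k opprK addrC; apply/esym.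
apply: (mutation_involutive q_central hM b_i chib hM' _ mut_seed_i) => r ri.
by apply: mut_seed_id; rewrite mxE eq_sym (negbTE ri).
Qed.

(** Mutation in direction [i] exchanges the two kinds of generators: [M' (evec i)] is the old
    exchange element and conversely. On exponents with zero [i]-th coordinate the frames agree. *)
Lemma local_alg_same x : local_alg q ex M' B' i x -> local_alg q ex M B i x.
Proof.
apply: gen_alg_sub => {x} x [[f fi ->]|[_ ->]]; last first.
  rewrite exchange_mut_seed; apply: gen_S; left; exists (evec i) => //.
  by rewrite mxE eqxx.
have [a fa] : exists a : nat, f 0 i = a%:Z by exists `|(f 0 i)%R|%N; lia.
have pow (a' : nat) : local_alg q ex M B i (M' (evec i *+ a')).
  elim: a' => [|a' IH]; first by rewrite (law0 hM'); apply: gen_1.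
  rewrite mulrS (torusD hM'); apply: gen_mul.
    by apply: gen_alg_Zq; apply: (chi_Zq q_central (law_chi hM')).
  apply: gen_mul => //; rewrite mut_seed_i; apply: gen_S; right; split => //.
rewrite -(subrK (evec i *+ a) f) (torusD hM'); apply: gen_mul.
  by apply: gen_alg_Zq; apply: (chi_Zq q_central (law_chi hM')).
apply: gen_mul; last exact: pow.
have h0 : (f - evec i *+ a) 0 i = 0.
  by rewrite mxE [X in _ + X]mxE mulmxnE mxE eqxx fa -mulr_natr natz mul1r subrr.
rewrite mut_seed_id //; apply: gen_S; left; exists (f - evec i *+ a) => //.
by rewrite h0.
Qed.

Section OtherDirection.
Variables (r : 'I_n) (c : 'rV[int]_n) (dc : int).
Hypothesis r_i : r != i.
Hypothesis c_i : c 0 i = 0.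
Hypothesis c_r : 0 <= c 0 r.
Hypothesis M'E : forall f, M' f = M (Emap i c f) * mut_prod q M c dc (f 0 i).
Hypothesis bE : r \in ex -> Emap i c (bcol B' r) = bcol B r.
Hypothesis c_pos : r \in ex -> B' i r != 0 -> 0 < c 0 r.
Variable phi : 'rV[int]_n -> int.
Hypothesis phiD : forall f g, phi (f + g) = phi f + phi g.
Hypothesis phic : 0 < phi c.
Hypothesis phi_r : r \in ex -> phi (bcol B r) = 0.

Let R := local_alg q ex M B r.
Let loc := localized q l ex M B r c.

Let Emap_r f : Emap i c f 0 r = f 0 r.
Proof. by rewrite mxE (negbTE r_i) max_l ?oppr_le0 // mulr0 addr0. Qed.

Let loc_R x : R x -> loc x. Proof. exact: localized_local. Qed.

Let locM x y : loc x -> loc y -> loc (x * y).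
Proof. exact: (localizedM q_central l_gt0 ql K_div hM indM phiD phic). Qed.

Let loc_prod m : loc (mut_prod q M c dc m).
Proof. exact: (mut_prod_localized ex q_central l_gt0 ql K_div B hM indM dc c_r phiD phic). Qed.

Let loc_monomial f : 0 <= f 0 r -> loc (M' f).
Proof.
move=> fr; rewrite M'E; apply: locM => //; apply: loc_R.
by apply: gen_S; left; exists (Emap i c f) => //; rewrite Emap_r.
Qed.

(* The positive degree of [M c] in [x_r] cancels the denominator [x_r] of [M g]. *)
Let prod_pos_local g (a : nat) : r \in ex -> g 0 r = -1 -> (a != 0%N -> 0 < c 0 r) ->
  R (M g * (mut_prod q M c dc a - 1)).
Proof.
move=> rex gr; case: a => [|a] hc; first by rewrite /= subrr mulr0; apply: gen_alg0.
have {}hc := hc isT.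
apply: local_alg_span.
apply: (tspanM q_central hM (P := pred1 g) (Q := fun f => 1 <= f 0 r)).
- by move=> f f' /eqP -> /= hf'; rewrite mxE gr addrC subr_ge0.
- by apply: tspan_gen; rewrite /= eqxx.
- apply: (mut_prod_pos_span q_central l_gt0 ql hM dc (D := fun f => 1 <= f 0 r)) => [|f hf] /=;
  first by rewrite gtz0_ge1 in hc.
  by rewrite mxE -[1]addr0 lerD // ltW.
Qed.

(** By [binomial_transfer] the two-term sum may be tested at any [h] with [h 0 r = -1], and a
    convenient one can be chosen. *)
Let exchange_loc : r \in ex -> loc (exchange_elt M' B' r).
Proof.
move=> rex.
have Brr : B' r r = 0 by apply: (compat_diag hB').
have br_r : bcol B' r 0 r = 0 by rewrite mxE.
suff [h hr hloc] : exists2 h : 'rV[int]_n, h 0 r = -1 & loc (M' h + M' (h + bcol B' r)).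
  rewrite exchange_eltE (binomial_transfer q_central l_gt0 ql hM' hB' rex hr) ?vposN_evec //.
  apply: locM; first by apply: loc_R; apply: gen_alg_Zq; apply: (chi_Zq q_central (law_chi hM')).
  by apply: locM => //; apply: loc_monomial; rewrite mxE [X in _ + X]mxE hr vposN_evec.
have eir : evec i 0 r = 0 by rewrite mxE (negbTE r_i).
have eri : evec r 0 i = 0 by rewrite mxE eq_sym (negbTE r_i).
have err : evec r 0 r = 1 by rewrite mxE eqxx.
have eii : evec i 0 i = 1 by rewrite mxE eqxx.
have binom := local_alg_binomial q_central l_gt0 ql hM hB rex.
have bi : bcol B' r 0 i = B' i r by rewrite mxE.
(* In each case one of [h] and [h + bcol B' r] has [i]-th coordinate 0 and the other a coordinate
   [a >= 0]. The first gives a monomial, the second a monomial times a product without inverses; the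
   constant terms combine into a binomial of the old seed. *)
case: (lerP 0 (B' i r)) => hm.
  have [a ha] : exists a : nat, B' i r = a%:Z by exists `|(B' i r)%R|%N; lia.
  exists (- evec r); first by rewrite mxE err.
  apply: loc_R.
  have hri : (- evec r) 0 i = 0 by rewrite mxE eri oppr0.
  rewrite (mut_seed_id hri) M'E EmapD bE // (Emap_id _ hri).
  have -> : (- evec r + bcol B' r) 0 i = a%:Z by rewrite mxE bi [X in X + _]mxE eri ha; lia.
  have -> : M (- evec r) + M (- evec r + bcol B r) * mut_prod q M c dc a =
     (M (- evec r) + M (- evec r + bcol B r)) + M (- evec r + bcol B r) * (mut_prod q M c dc a - 1).
    by rewrite mulrBr mulr1 -[RHS]addrA [X in _ = _ + X]addrC subrK.
  apply: gen_add; first by apply: binom; rewrite mxE err.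
  apply: prod_pos_local => //; first by rewrite mxE [X in X + _]mxE err mxE (compat_diag hB).
  by move=> a0; apply: c_pos => //; rewrite ha; lia.
have [a ha] : exists a : nat, - B' i r = a%:Z by exists `|(B' i r)%R|%N; lia.
pose h := - evec r + evec i *~ a%:Z.
have hr : h 0 r = -1 by rewrite mxE mxzE eir [X in X + _]mxE err; lia.
have hi : h 0 i = a by rewrite mxE mxzE eii [X in X + _]mxE eri; lia.
exists h => //; apply: loc_R.
have hbi : (h + bcol B' r) 0 i = 0 by rewrite mxE hi bi; lia.
rewrite [M' (h + _)]M'E hbi /= mulr1 EmapD bE // M'E hi.
have -> : M (Emap i c h) * mut_prod q M c dc a + M (Emap i c h + bcol B r) =
     (M (Emap i c h) + M (Emap i c h + bcol B r)) + M (Emap i c h) * (mut_prod q M c dc a - 1).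
  by rewrite mulrBr mulr1 [RHS]addrC addrA subrK.
apply: gen_add; first by apply: binom; rewrite Emap_r.
apply: prod_pos_local => //; first by rewrite Emap_r.
by move=> a0; apply: c_pos => //; lia.
Qed.

(** [c] is one of [b] and [- b], with a sign for which [M c] has no negative power of $x_r$ and thus
    lies in [R]. Inverting [center_elt] inverts all factors of the products, so the generators of
    the mutated algebra become available; [phi] removes the denominator again. *)
Lemma local_alg_other x : tspan q M predT x -> local_alg q ex M' B' r x -> local_alg q ex M B r x.
Proof.
move=> hx hR; apply: (localized_cancel q_central l_gt0 hM indM hB c_r phiD phic phi_r hx).
move: hR; apply: (localized_gen q_central l_gt0 ql K_div hM indM c_r phiD phic).
by move=> y [[f fr ->]|[rex ->]]; [apply: loc_monomial|apply: exchange_loc].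
Qed.

End OtherDirection.

(** If [B r i] is nonzero, the exponent of $x_r$ is a grading that is nonzero on [b] and vanishes on
    column [r]. If it is zero, this coordinate does not see [b], and the functional dual to [b]
    separates the two binomials. *)
Lemma upper_bound_mut x : upper_bound q ex M' B' x -> upper_bound q ex M B x.
Proof.
move=> hx.
have Ti : tspan q M predT x by apply: (local_alg_torus q_central hM); apply: local_alg_same;
  apply: hx.
move=> r; have [->|ri] := eqVneq r i; first exact/local_alg_same/hx.
have hBB : B' i r = - B i r by apply: mutB_k.
have EB : r \in ex -> Emap i b (bcol B' r) = bcol B r + b *~ Num.max 0 (B i r).
  by move=> _; apply: Emap_bcol_mutB => //; apply: (compat_diag hB).
have sgn : r \in ex -> _ := compat_sign hB iex.
have M'E f : M' f = M (Emap i b f) * mut_prod q M b (d i) (f 0 i) by [].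
have coordD f g : (f + g) 0 r = f 0 r + g 0 r by rewrite mxE.
have coord_r : r \in ex -> bcol B r 0 r = 0 by move=> rex; rewrite mxE (compat_diag hB).
have br : b 0 r = B r i by rewrite mxE.
have bN_i : (- b) 0 i = 0 by rewrite mxE b_i oppr0.
case: (ltrgt0P (B r i)) => hs.
- apply: (@local_alg_other r b (d i) ri b_i _ M'E _ _ (fun f => f 0 r)) => //.
  + by rewrite br ltW.
  + by move=> rex; rewrite EB //; have [h1 h2 h3] := sgn rex; rewrite max_l ?mulr0z ?addr0 //; lia.
  + by rewrite br.
  + by rewrite br.
- apply: (@local_alg_other r (- b) (- d i) ri bN_i _ _ _ _ (fun f => f 0 r)) => //.
  + by rewrite mxE br; lia.
  + by move=> f; rewrite -/(mut_frame q i M (- b) (- d i) f)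
      (mut_frameN q_central l_gt0 ql hM b_i chib mut_factor_unit mut_factor_unitN).
  + move=> rex; rewrite EmapN // EB // [bcol B' r 0 i]mxE hBB.
    have [h1 h2 h3] := sgn rex; rewrite max_r; last by lia.
    by rewrite -addrA -mulrzDr subrr mulr0z addr0.
  + by move=> rex _; rewrite mxE br; lia.
  + by rewrite mxE br; lia.
- have [phi [phiD phib phi0]] := dual_phi.
  apply: (@local_alg_other r b (d i) ri b_i _ M'E _ _ phi) => //.
  + by rewrite br hs.
  + move=> rex; rewrite EB //; have [h1 h2 h3] := sgn rex.
    have Bir : B i r = 0 by lia.
    by rewrite Bir maxxx mulr0z addr0.
  + by move=> rex; rewrite hBB; have [h1 h2 h3] := sgn rex; lia.
  + by rewrite phib.
  + by move=> rex; apply: phi0.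
Qed.

Lemma upper_bound_cluster j : upper_bound q ex M B (M (evec j)).
Proof. by move=> r; apply: gen_S; left; exists (evec j) => //; rewrite mxE; case: eqP. Qed.

End Step.

(** * Ultrapowers of division rings *)

Definition nonprincipal : set_system nat := projT1 (cid (ultraFilterLemma eventually_filter)).

Lemma nonprincipal_ultra : UltraFilter nonprincipal.
Proof. by rewrite /nonprincipal; case: cid => U []. Qed.

Lemma nonprincipal_eventually A : eventually A -> nonprincipal A.
Proof. by rewrite /nonprincipal; case: cid => U /= [_]; apply. Qed.

#[local] Instance nonprincipal_filter : ProperFilter nonprincipal :=
  @ultra_proper _ _ nonprincipal_ultra.

Lemma nonprincipalC (A : set nat) : ~ nonprincipal A -> nonprincipal (~` A)%classic.
Proof. by case: (in_ultra_setVsetC A nonprincipal_ultra). Qed.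

Section Ultrapower.
Local Open Scope quotient_scope.
Variable F : unitRingType.

Definition ueq (x y : nat -> F) : bool := `[< nonprincipal (fun n => x n = y n) >].

Lemma ueqP x y : reflect (nonprincipal (fun n => x n = y n)) (ueq x y).
Proof. exact: asboolP. Qed.

Lemma ueq_refl : reflexive ueq.
Proof. by move=> x; apply/ueqP; apply: filterS filterT. Qed.
Lemma ueq_sym : symmetric ueq.
Proof. by move=> x y; apply/ueqP/ueqP; apply: filterS => n ->. Qed.
Lemma ueq_trans : transitive ueq.
Proof. by move=> y x z /ueqP h1 /ueqP h2; apply/ueqP; apply: filterS2 h1 h2 => n -> ->. Qed.

Definition ueq_equiv := EquivRel ueq ueq_refl ueq_sym ueq_trans.

Definition ultrapower := {eq_quot ueq_equiv}.
HB.instance Definition _ := Choice.on ultrapower.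
HB.instance Definition _ : EqQuotient _ ueq_equiv ultrapower := EqQuotient.on ultrapower.

Definition ucl (x : nat -> F) : ultrapower := \pi_ultrapower x.

Lemma ucl_eq x y : (ucl x = ucl y) <-> nonprincipal (fun n => x n = y n).
Proof.
split; first by move=> /eqquotP /ueqP.
by move=> h; apply/eqquotP/ueqP.
Qed.

Lemma ucl_ind (P : ultrapower -> Prop) : (forall x, P (ucl x)) -> forall x, P x.
Proof. by move=> h x; rewrite -(reprK x); apply: h. Qed.

Definition umap (f : F -> F) (x : ultrapower) : ultrapower := ucl (fun n => f (repr x n)).
Definition umap2 (f : F -> F -> F) (x y : ultrapower) : ultrapower :=
  ucl (fun n => f (repr x n) (repr y n)).

Lemma repr_ucl x : nonprincipal (fun n => repr (ucl x) n = x n).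
Proof. by apply/ucl_eq; rewrite /ucl reprK. Qed.

Lemma umapE f x : umap f (ucl x) = ucl (fun n => f (x n)).
Proof. by apply/ucl_eq; apply: filterS (repr_ucl x) => n ->. Qed.

Lemma umap2E f x y : umap2 f (ucl x) (ucl y) = ucl (fun n => f (x n) (y n)).
Proof. by apply/ucl_eq; apply: filterS2 (repr_ucl x) (repr_ucl y) => n -> ->. Qed.

Definition uconst (a : F) : ultrapower := ucl (fun=> a).
Definition uadd := umap2 +%R.
Definition umul := umap2 *%R.
Definition uopp := umap -%R.

Fact uaddA : associative uadd.
Proof. by elim/ucl_ind=> x; elim/ucl_ind=> y; elim/ucl_ind=> z; rewrite /uadd !umap2E; congr ucl;
  apply: funext => n; rewrite addrA. Qed.
Fact uaddC : commutative uadd.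
Proof. by elim/ucl_ind=> x; elim/ucl_ind=> y; rewrite /uadd !umap2E; congr ucl;
  apply: funext => n; rewrite addrC. Qed.
Fact uadd0 : left_id (uconst 0) uadd.
Proof. by elim/ucl_ind=> x; rewrite /uadd !umap2E; congr ucl; apply: funext => n;
  rewrite add0r. Qed.
Fact uaddN : left_inverse (uconst 0) uopp uadd.
Proof. by elim/ucl_ind=> x; rewrite /uadd /uopp umapE umap2E; congr ucl; apply: funext => n;
  rewrite addNr. Qed.

HB.instance Definition _ := GRing.isZmodule.Build ultrapower uaddA uaddC uadd0 uaddN.

Fact umulA : associative umul.
Proof. by elim/ucl_ind=> x; elim/ucl_ind=> y; elim/ucl_ind=> z; rewrite /umul !umap2E; congr ucl;
  apply: funext => n; rewrite mulrA. Qed.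
Fact umul1 : left_id (uconst 1) umul.
Proof. by elim/ucl_ind=> x; rewrite /umul !umap2E; congr ucl; apply: funext => n;
  rewrite mul1r. Qed.
Fact umulr1 : right_id (uconst 1) umul.
Proof. by elim/ucl_ind=> x; rewrite /umul !umap2E; congr ucl; apply: funext => n;
  rewrite mulr1. Qed.
Fact umulDl : left_distributive umul uadd.
Proof. by elim/ucl_ind=> x; elim/ucl_ind=> y; elim/ucl_ind=> z; rewrite /umul /uadd !umap2E;
  congr ucl; apply: funext => n; rewrite mulrDl. Qed.
Fact umulDr : right_distributive umul uadd.
Proof. by elim/ucl_ind=> x; elim/ucl_ind=> y; elim/ucl_ind=> z; rewrite /umul /uadd !umap2E;
  congr ucl; apply: funext => n; rewrite mulrDr. Qed.
Fact uone_neq0 : uconst 1 != uconst 0.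
Proof.
apply/eqP => /ucl_eq h; apply: (@filter_not_empty _ nonprincipal).
by apply: filterS h => n /eqP; rewrite oner_eq0.
Qed.

HB.instance Definition _ := GRing.Zmodule_isNzRing.Build ultrapower
  umulA umul1 umulr1 umulDl umulDr uone_neq0.

Lemma ucl0 : ucl (fun=> 0) = 0. Proof. by []. Qed.
Lemma ucl1 : ucl (fun=> 1) = 1. Proof. by []. Qed.
Lemma uclM x y : ucl x * ucl y = ucl (fun n => x n * y n).
Proof. exact: umap2E. Qed.
Lemma uclD x y : ucl x + ucl y = ucl (fun n => x n + y n).
Proof. exact: umap2E. Qed.
Lemma uclN x : - ucl x = ucl (fun n => - x n).
Proof. exact: umapE. Qed.

Definition uunit : {pred ultrapower} :=
  fun x => `[< nonprincipal (fun n => repr x n \is a GRing.unit) >].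
Definition uinv (x : ultrapower) : ultrapower := umap GRing.inv x.

Lemma uunitP x : reflect (nonprincipal (fun n => x n \is a GRing.unit)) (ucl x \in uunit).
Proof.
apply: (iffP (asboolP _)) => h; apply: filterS2 h (repr_ucl x).
  by move=> n /[swap] ->.
by move=> n /[swap] ->.
Qed.

Fact umulVr : {in uunit, left_inverse 1 uinv *%R}.
Proof.
elim/ucl_ind=> x /uunitP hx; rewrite /uinv umapE uclM -ucl1; apply/ucl_eq.
by apply: filterS hx => n; apply: mulVr.
Qed.
Fact umulrV : {in uunit, right_inverse 1 uinv *%R}.
Proof.
elim/ucl_ind=> x /uunitP hx; rewrite /uinv umapE uclM -ucl1; apply/ucl_eq.
by apply: filterS hx => n; apply: mulrV.
Qed.
Fact uunitPl x y : y * x = 1 /\ x * y = 1 -> x \in uunit.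
Proof.
elim/ucl_ind: x => x; elim/ucl_ind: y => y; rewrite !uclM -!ucl1.
case=> /ucl_eq h1 /ucl_eq h2; apply/uunitP.
by apply: filterS2 h1 h2 => n h1 h2; apply/unitrP; exists (y n).
Qed.
Fact uinv_out : {in [predC uunit], uinv =1 id}.
Proof.
elim/ucl_ind=> x /= hx; rewrite /uinv umapE; apply/ucl_eq.
have /nonprincipalC : ~ nonprincipal (fun n => x n \is a GRing.unit).
  by move=> h; move: hx; rewrite inE /= => /negP; apply; apply/uunitP.
by apply: filterS => n /= /negP hn; rewrite invr_out.
Qed.

HB.instance Definition _ := GRing.NzRing_hasMulInverse.Build ultrapower
  umulVr umulrV uunitPl uinv_out.

Fact uconst_zmod : zmod_morphism uconst.
Proof. by move=> a b; rewrite /uconst uclN uclD. Qed.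
Fact uconst_monoid : monoid_morphism uconst.
Proof. by split=> // a b; rewrite /uconst uclM. Qed.
HB.instance Definition _ := GRing.isZmodMorphism.Build F ultrapower uconst uconst_zmod.
HB.instance Definition _ := GRing.isMonoidMorphism.Build F ultrapower uconst uconst_monoid.

(** Maximality of the filter turns a sequence that is not almost everywhere zero into one that is
    almost everywhere nonzero, hence invertible. *)
Lemma ultrapower_div : (forall x : F, x != 0 -> x \is a GRing.unit) ->
  forall x : ultrapower, x != 0 -> x \is a GRing.unit.
Proof.
move=> hF; elim/ucl_ind=> x hx; apply/uunitP.
have /nonprincipalC : ~ nonprincipal (fun n => x n = 0).
  by move=> h; move/eqP: hx; apply; rewrite -ucl0; apply/ucl_eq.
by apply: filterS => n /= /eqP /hF.
Qed.

Definition uomega : ultrapower := ucl (fun n => n%:R).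

Lemma uomega_central x : uomega * x = x * uomega.
Proof.
elim/ucl_ind: x => x; rewrite /uomega !uclM; congr ucl; apply: funext => n.
by rewrite mulr_natl mulr_natr.
Qed.

Lemma ucl_sum (I : Type) (s : seq I) (f : I -> nat -> F) :
  \sum_(i <- s) ucl (f i) = ucl (fun n => \sum_(i <- s) f i n).
Proof.
elim: s => [|i s IH]; first by rewrite big_nil -ucl0; congr ucl; apply: funext => n;
  rewrite big_nil.
by rewrite big_cons IH uclD; congr ucl; apply: funext => n; rewrite big_cons.
Qed.

Lemma uomegaX k : uomega ^+ k = ucl (fun n => n%:R ^+ k).
Proof.
elim: k => [|k IH]; first by rewrite expr0 -ucl1; congr ucl; apply: funext.
by rewrite exprS IH uclM; congr ucl; apply: funext => n; rewrite exprS.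
Qed.

Lemma horner_uomega (p : {poly F}) : (map_poly uconst p).[uomega] = ucl (fun n => p.[n%:R]).
Proof.
rewrite (horner_coef_wide _ (size_poly _ _)).
rewrite (eq_bigr (fun i : 'I_(size p) => ucl (fun n => p`_i * n%:R ^+ i))); last first.
  by move=> i _; rewrite coef_map uomegaX uclM.
by rewrite ucl_sum; congr ucl; apply: funext => n; rewrite horner_coef.
Qed.

(** The hypothesis says that [p] vanishes at infinitely many natural numbers. These are central and
    have invertible differences, so the usual bound on the number of roots holds although [F] need
    not be commutative. *)
Lemma uomega_transcendental (p : {poly F}) :
  (forall x : F, x != 0 -> x \is a GRing.unit) -> (forall n : nat, (n.+1)%:R != 0 :> F) ->
  (map_poly uconst p).[uomega] = 0 -> p = 0.
Proof.
move=> hF h0; rewrite horner_uomega -ucl0 => /ucl_eq hU.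
apply/eqP/negP => /negP p0.
suff [rs [_ /eqP szrs allr urs]] : exists rs : seq nat,
    [/\ sorted gtn rs, size rs == size p, all (root p) (map (fun n => n%:R) rs) &
     uniq_roots (map (fun n => n%:R : F) rs)].
  by have := max_ring_poly_roots p0 allr urs; rewrite size_map szrs ltnn.
elim: (size p) => [|m [rs [srs szrs allr urs]]]; first by exists [::].
(* The list of roots is kept decreasing: its head bounds it, and any root beyond the head is new. *)
have [n [hn hnr]] : exists n, (head 0%N rs < n)%N /\ p.[n%:R] = 0.
  have hev : nonprincipal (fun n => (head 0%N rs < n)%N).
    by apply: nonprincipal_eventually; exists (head 0%N rs).+1.
  by have [n [? ?]] := filter_ex (filterI hev hU); exists n.
have hlt : all (fun k => k < n)%N rs.
  apply/allP => k hk; apply: leq_ltn_trans hn.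
  case: rs srs hk {szrs allr urs} => [//|a rs] /= srs; rewrite inE => /orP[/eqP -> //|hk].
  by apply: ltnW; have := order_path_min (rev_trans ltn_trans) srs => /allP/(_ _ hk).
exists (n :: rs); split => /=.
- by case: rs srs hlt {szrs allr urs hn} => //= a rs -> /andP[-> _].
- by rewrite eqSS.
- by rewrite rootE hnr eqxx.
- rewrite urs andbT all_map; apply/allP => k /(allP hlt) hkn /=.
  apply/andP; split; first by rewrite mulr_natl mulr_natr.
  apply: hF; rewrite -opprB oppr_eq0 -natrB ?(ltnW hkn)//.
  by case: (n - k)%N (subn_gt0 k n) => [|i _]; [rewrite hkn|exact: h0].
Qed.

End Ultrapower.

(** * Adjoining central frozen variables *)

(* [S] is the graph of a partial ring morphism [K -> F] along which the frame [M'] specializes to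
   [M]; the coordinates killed by [pi] are specialized to 1. *)
Record extension (F : unitRingType) (q : F) (n : nat) (M : 'rV[int]_n -> F)
    (chi : 'rV[int]_n -> 'rV[int]_n -> F) (n' : nat) (pi : 'rV[int]_n' -> 'rV[int]_n)
    (K : unitRingType) (q' : K) (M' : 'rV[int]_n' -> K) (chi' : 'rV[int]_n' -> 'rV[int]_n' -> K)
    (S : K -> F -> Prop) : Prop := Extension {
  ext_div : forall x : K, x != 0 -> x \is a GRing.unit;
  ext_char0 : forall m : nat, (m.+1)%:R != 0 :> K;
  ext_central : forall x : K, q' * x = x * q';
  ext_exp : forall m : int, q ^ m = 1 -> q' ^ m = 1;
  ext_law : torus_law q' M' chi';
  ext_indep : independent q' M';
  ext_fun : forall x a b, S x a -> S x b -> a = b;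
  ext1 : S 1 1;
  extq : S q' q;
  extN : forall x a, S x a -> S (- x) (- a);
  extD : forall x y a b, S x a -> S y b -> S (x + y) (a + b);
  extM : forall x y a b, S x a -> S y b -> S (x * y) (a * b);
  ext_frame : forall f, S (M' f) (M (pi f));
  ext_chi : forall f g, S (chi' f g) (chi (pi f) (pi g));
  ext_chi_pow : forall f g (m : int), chi (pi f) (pi g) = q ^ m -> chi' f g = q' ^ m }.

Section AdjoinOne.
Variables (F : unitRingType) (q : F) (n : nat).
Hypothesis F_div : forall x : F, x != 0 -> x \is a GRing.unit.
Hypothesis F_char0 : forall m : nat, (m.+1)%:R != 0 :> F.
Hypothesis q_central : forall x : F, q * x = x * q.
Variables (M : 'rV[int]_n -> F) (chi : 'rV[int]_n -> 'rV[int]_n -> F).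
Hypothesis hM : torus_law q M chi.
Hypothesis indM : independent q M.
Hypothesis q_unit : q \is a GRing.unit.

Local Notation K := (ultrapower F).
Local Notation iota := (@uconst F).
Local Notation y := (uomega F).

Let iotaXz (m : int) : (iota q) ^ m = iota (q ^ m).
Proof.
case: m => a; first by rewrite -!exprnP -rmorphXn.
by rewrite !NegzE -!exprnN -rmorphXn -rmorphV // unitrX.
Qed.

Let K_div : forall x : K, x != 0 -> x \is a GRing.unit.
Proof. exact: ultrapower_div. Qed.

Let y_unit : y \is a GRing.unit.
Proof.
apply: K_div; apply/eqP => y0.
have : 'X = 0 :> {poly F}.
  by apply: uomega_transcendental => //; rewrite map_polyX hornerX.
by apply/eqP; rewrite polyX_eq0.
Qed.

Let yM x : y * x = x * y. Proof. exact: uomega_central. Qed.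
Let yzM (m : int) x : y ^ m * x = x * y ^ m.
Proof.
have hn (a : nat) z : y ^+ a * z = z * y ^+ a by apply/esym; apply: commrX; rewrite /GRing.comm yM.
case: m => a; first exact: hn.
rewrite NegzE -exprnN; apply/esym; apply: commrV; exact/esym/hn.
Qed.

Definition adjoin_frame (f : 'rV[int]_(1 + n)) : K := y ^ (f 0 0) * iota (M (rsubmx f)).
Definition adjoin_chi (f g : 'rV[int]_(1 + n)) : K := iota (chi (rsubmx f) (rsubmx g)).

Let hchi := law_chi hM.

Let sub0D (f g : 'rV[int]_(1 + n)) : rsubmx (f + g) = rsubmx f + rsubmx g.
Proof. exact: raddfD. Qed.

Lemma adjoin_law : torus_law (iota q) adjoin_frame adjoin_chi.
Proof.
split.
- split=> [f g h|f g h|f g|f g]; rewrite /adjoin_chi.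
  + by rewrite sub0D (chiDl hchi) rmorphM.
  + by rewrite sub0D (chiDr hchi) rmorphM.
  + by rewrite -rmorphM (chi_skew hchi) rmorph1.
  + have [m ->] := chi_pow hchi (rsubmx f) (rsubmx g); exists m.
    exact: rmorphXn.
- by rewrite /adjoin_frame mxE raddf0 (law0 hM) rmorph1 expr0z mulr1.
move=> f g; rewrite /adjoin_frame /adjoin_chi sub0D -mulrA (mulrA (iota _)) -yzM -!mulrA.
rewrite -rmorphM (lawM hM) rmorphM !mulrA -exprzDr // mxE.
by rewrite -yzM.
Qed.

Lemma Zq_iota x : in_Zq (iota q) x -> exists2 a, in_Zq q a & x = iota a.
Proof.
case=> m [a ->]; exists (\sum_(i < m) (a i)%:~R * q ^+ i); first by exists m, a.
rewrite [RHS]rmorph_sum; apply: eq_bigr => i _.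
by rewrite rmorphM rmorphXn rmorph_int.
Qed.

(** After clearing negative powers of [y], a relation is a polynomial over [F] vanishing at [y]. By
    transcendence each of its coefficients vanishes, and each is a relation for [M]. *)
Lemma adjoin_indep : independent (iota q) adjoin_frame.
Proof.
move=> s c us hc.
have /choice[c0 hc0] : forall f, exists a, in_Zq q a /\ c f = iota a.
  by move=> f; have [a ha ->] := Zq_iota (hc f); exists a.
move=> s0 f0 f0s.
pose A := (\sum_(f <- s) `|(f 0 0)%R|)%N.
have hA (f : 'rV[int]_(1 + n)) : f \in s -> (`|(f 0 0)%R| <= A)%N.
  by move=> hg; rewrite /A (big_rem f) //= leq_addr.
clearbody A.
pose e (f : 'rV[int]_(1 + n)) := `|(f 0 0 + A%:Z)%R|%N.
have he f : f \in s -> (e f)%:Z = f 0 0 + A%:Z.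
  by move=> /hA; rewrite /e; move: (f 0 0) => z hz; lia.
pose p := \sum_(f <- s) (c0 f * M (rsubmx f))%:P * 'X^(e f) : {poly F}.
have p0 : p = 0.
  apply: uomega_transcendental => //.
  transitivity ((\sum_(f <- s) c f * adjoin_frame f) * y ^ A%:Z); last by rewrite s0 mul0r.
  rewrite mulr_suml /p rmorph_sum horner_sum big_seq [RHS]big_seq; apply: eq_bigr => f fs.
  rewrite rmorphM /= map_polyC map_polyXn hornerCM hornerXn /=.
  rewrite rmorphM (proj2 (hc0 f)) /adjoin_frame yzM -!mulrA; congr (_ * (_ * _)).
  by rewrite -exprzDr // -he.
have coef j : \sum_(f <- s | e f == j) c0 f * M (rsubmx f) = 0.
  rewrite -[RHS](coef0 F j) -p0 /p coef_sum big_mkcond; apply: eq_bigr => f _.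
  rewrite coefCM coefXn eq_sym.
  by case: eqP => _; rewrite ?mulr1 ?mulr0.
rewrite (proj2 (hc0 f0)).
have -> : c0 f0 = 0; last exact: rmorph0.
(* Among exponents with the same power of [y], the remaining coordinates determine the whole vector,
   so the coefficients can be reindexed by them. *)
pose c1 g := c0 (row_mx (const_mx (f0 0 0)) g).
have hf (f : 'rV[int]_(1 + n)) : f \in s -> e f == e f0 ->
  f = row_mx (const_mx (f0 0 0)) (rsubmx f).
  move=> fs /eqP ef; have ef' : f 0 0 = f0 0 0.
    by apply: (addIr A%:Z); rewrite -!he // ef.
  rewrite -[LHS]hsubmxK; congr row_mx; apply/rowP => j; rewrite !mxE ord1 -ef'; congr (f 0 _).
  exact: val_inj.
have -> : c0 f0 = c1 (rsubmx f0) by rewrite /c1 -hf.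
pose s1 := [seq rsubmx f | f <- s & e f == e f0].
apply: (indM (s := s1)); last 1 first.
- by apply: map_f; rewrite mem_filter eqxx.
- rewrite map_inj_in_uniq ?filter_uniq // => f g.
  by rewrite !mem_filter => /andP[ef fs] /andP[eg gs] efg; rewrite (hf f) // (hf g) // efg.
- by move=> f; apply: (proj1 (hc0 _)).
rewrite big_map big_filter -[RHS](coef (e f0)) big_seq_cond [RHS]big_seq_cond.
by apply: eq_bigr => f /andP[fs ef]; rewrite /c1 -hf.
Qed.

(** The graph of evaluation at [y = 1] on Laurent polynomials in [y] over [F], a proper part of the
    ultrapower in general. It is single-valued because [y] is transcendental and multiplicative
    because [y] and 1 are central. *)
Definition adjoin_spec (x : K) (z : F) : Prop :=
  exists (p : {poly F}) (a : nat), x * y ^+ a = (map_poly iota p).[y] /\ z = p.[1].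

Let hornerMy (p p' : {poly F}) : (map_poly iota (p * p')).[y] = (map_poly iota p).[y] *
  (map_poly iota p').[y].
Proof.
have -> : map_poly iota (p * p') = map_poly iota p * map_poly iota p' by apply: (rmorphM
  (map_poly iota)).
by rewrite hornerM_comm // /comm_poly yM.
Qed.

Let hornerDy (p p' : {poly F}) : (map_poly iota (p + p')).[y] = (map_poly iota p).[y] +
  (map_poly iota p').[y].
Proof.
have -> : map_poly iota (p + p') = map_poly iota p + map_poly iota p' by apply: (rmorphD
  (map_poly iota)).
by rewrite hornerD.
Qed.

Let hornerXny a : (map_poly iota 'X^a).[y] = y ^+ a.
Proof.
have -> : map_poly iota 'X^a = 'X^a by apply: map_polyXn.
by rewrite hornerXn.
Qed.

Let hornerCy a : (map_poly iota a%:P).[y] = iota a.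
Proof.
have -> : map_poly iota a%:P = (iota a)%:P by apply: map_polyC.
by rewrite hornerC.
Qed.

Let hornerM1 (p p' : {poly F}) : (p * p').[1] = p.[1] * p'.[1].
Proof. by rewrite hornerM_comm // /comm_poly mul1r mulr1. Qed.

Lemma adjoin_extension :
  extension q M chi (fun f : 'rV[int]_(1 + n) => rsubmx f)
    (iota q) adjoin_frame adjoin_chi adjoin_spec.
Proof.
have iotaE a : adjoin_spec (iota a) a.
  by exists a%:P, 0%N; rewrite expr0 mulr1 hornerCy hornerC.
split.
- exact: K_div.
- move=> m; apply/eqP => h; have := F_char0 m; apply/negP/negPn/eqP.
  have := uomega_transcendental (p := (m.+1)%:R%:P) F_div F_char0.
  have h' : iota m.+1%:R = 0 by rewrite rmorph_nat.
  rewrite map_polyC /= hornerC => /(_ h') /eqP.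
  by rewrite polyC_eq0 => /eqP.
- elim/ucl_ind => x; rewrite /uconst !uclM; congr ucl; apply: funext => m.
  exact: q_central.
- by move=> m; rewrite iotaXz => ->; apply: rmorph1.
- exact: adjoin_law.
- exact: adjoin_indep.
- move=> x z z' [p [a [hp ->]]] [p' [a' [hp' ->]]].
  have : p * 'X^a' - p' * 'X^a = 0.
    apply: uomega_transcendental => //.
    rewrite -mulNr hornerDy !hornerMy !hornerXny.
    have -> : (map_poly iota (- p')).[y] = - (map_poly iota p').[y].
      have -> : map_poly iota (- p') = - map_poly iota p' by apply: (rmorphN (map_poly iota)).
      by rewrite hornerN.
    by rewrite -hp -hp' mulNr -!mulrA -!exprD addnC subrr.
  move/eqP; rewrite subr_eq0 => /eqP /(congr1 (fun p : {poly F} => p.[1])).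
  by rewrite !hornerM1 !hornerXn !expr1n !mulr1.
- exact: (iotaE 1).
- exact: iotaE.
- move=> x a [p [m [hp ->]]]; exists (- p), m; rewrite hornerN mulNr hp; split => //.
  have -> : map_poly iota (- p) = - map_poly iota p by apply: (rmorphN (map_poly iota)).
  by rewrite hornerN.
- move=> x z a b [p [m [hp ->]]] [p' [m' [hp' ->]]].
  exists (p * 'X^m' + p' * 'X^m), (m + m')%N.
  rewrite hornerD !hornerM1 !hornerXn !expr1n !mulr1; split => //.
  rewrite hornerDy !hornerMy !hornerXny -hp -hp' mulrDl -!mulrA -!exprD.
  by rewrite [(m' + m)%N]addnC.
- move=> x z a b [p [m [hp ->]]] [p' [m' [hp' ->]]].
  exists (p * p'), (m + m')%N; rewrite hornerM1 hornerMy -hp -hp'; split => //.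
  have yXM : y ^+ m * z = z * y ^+ m := yzM m%:Z z.
  by rewrite exprD -!mulrA; congr (x * _); rewrite !mulrA yXM.
- move=> f; rewrite /adjoin_frame; case: (f 0 0) => a.
    exists ((M (rsubmx f))%:P * 'X^a), 0%N.
    rewrite hornerMy hornerCy hornerXny expr0 mulr1 hornerM1 hornerC hornerXn expr1n mulr1.
    by rewrite -(yzM (Posz a)).
  exists (M (rsubmx f))%:P, a.+1; rewrite hornerCy hornerC; split => //.
  by rewrite yzM -mulrA NegzE -exprnN mulVr ?mulr1 // unitrX.
- by move=> f g; apply: iotaE.
- by move=> f g m; rewrite /adjoin_chi iotaXz => ->.
Qed.

End AdjoinOne.

Lemma extension_trans (F K K2 : unitRingType) (q : F) (q1 : K) (q2 : K2) (n n1 n2 : nat)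
    M chi (pi : 'rV[int]_n1 -> 'rV[int]_n) M1 chi1 S1 (pi1 : 'rV[int]_n2 ->
      'rV[int]_n1) M2 chi2 S2 :
  extension q M chi pi q1 M1 chi1 S1 -> extension q1 M1 chi1 pi1 q2 M2 chi2 S2 ->
  extension q M chi (fun f => pi (pi1 f)) q2 M2 chi2
    (fun x a => exists2 z, S2 x z & S1 z a).
Proof.
move=> h1 h2; split.
- exact: (ext_div h2).
- exact: (ext_char0 h2).
- exact: (ext_central h2).
- by move=> m /(ext_exp h1)/(ext_exp h2).
- exact: (ext_law h2).
- exact: (ext_indep h2).
- move=> x a b [z hz ha] [z' hz' hb]; apply: (ext_fun h1 ha).
  by rewrite (ext_fun h2 hz hz').
- by exists 1; [apply: ext1 h2|apply: (ext1 h1)].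
- by exists q1; [apply: (extq h2)|apply: (extq h1)].
- by move=> x a [z hz ha]; exists (- z); [apply: (extN h2)|apply: (extN h1)].
- move=> x x' a a' [z hz ha] [z' hz' ha']; exists (z + z'); first exact: (extD h2).
  exact: (extD h1).
- move=> x x' a a' [z hz ha] [z' hz' ha']; exists (z * z'); first exact: (extM h2).
  exact: (extM h1).
- by move=> f; exists (M1 (pi1 f)); [apply: (ext_frame h2)|apply: (ext_frame h1)].
- move=> f g; exists (chi1 (pi1 f) (pi1 g)); first exact: (ext_chi h2).
  exact: (ext_chi h1).
- by move=> f g m /(ext_chi_pow h1)/(ext_chi_pow h2).
Qed.

Lemma adjoin_many (F : unitRingType) (q : F) (l n : nat) M chi m :
  (forall x : F, x != 0 -> x \is a GRing.unit) -> (forall m : nat, (m.+1)%:R != 0 :> F) ->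
  (forall x : F, q * x = x * q) -> (0 < l)%N -> q ^+ l = 1 ->
  torus_law q M chi -> independent q M ->
  exists (K : unitRingType) (q' : K) M' chi' S,
    extension q M chi (fun f : 'rV[int]_(m + n) => rsubmx f) q' M' chi' S.
Proof.
move=> F_div F_char0 q_central l_gt0 ql hM indM.
elim: m => [|m [K [q1 [M1 [chi1 [S1 h1]]]]]].
  have rE (f : 'rV[int]_(0 + n)) : rsubmx f = f :> 'rV[int]_n.
    by apply/rowP => j; rewrite mxE; congr (f _ _); apply: val_inj.
  exists F, q, M, chi, (fun x a => x = a).
  split => //; first by move=> x a b -> ->.
  - by move=> x a ->.
  - by move=> x x' a a' -> ->.
  - by move=> x x' a a' -> ->.
  - by move=> f; rewrite rE.
  - by move=> f g; rewrite !rE.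
  - by move=> f g k; rewrite !rE.
have q1l : q1 ^+ l = 1 by apply: (ext_exp h1 (m := l%:Z)).
have h2 := adjoin_extension (ext_div h1) (ext_char0 h1) (ext_central h1) (ext_law h1)
  (ext_indep h1) (root_unit l_gt0 q1l).
have h3 := extension_trans h1 h2.
eexists; eexists; eexists; eexists; eexists.
have e : (fun f : 'rV[int]_(1 + (m + n)) => rsubmx (rsubmx f)) =
  (fun f : 'rV[int]_(m.+1 + n) => rsubmx f).
  apply: funext => f; apply/rowP => j; rewrite !mxE; congr (f _ _); exact: val_inj.
rewrite -e; exact: h3.
Qed.

(** * Toric frames *)

Section Bform.
Variable n : nat.
Implicit Types (Lam : 'M[int]_n) (f g h : 'rV[int]_n).

Lemma bformDl Lam f g h : bform Lam (f + g) h = bform Lam f h + bform Lam g h.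
Proof. by rewrite /bform !mulmxDl mxE. Qed.

Lemma bformDr Lam f g h : bform Lam f (g + h) = bform Lam f g + bform Lam f h.
Proof. by rewrite /bform raddfD mulmxDr mxE. Qed.

Lemma bformE Lam f g : bform Lam f g = \sum_i \sum_j f 0 j * Lam j i * g 0 i.
Proof. by rewrite /bform mxE; apply: eq_bigr => i _; rewrite !mxE mulr_suml. Qed.

Lemma bform_evec Lam i j : bform Lam (evec i) (evec j) = Lam i j.
Proof.
rewrite bformE (bigD1 j) //= (bigD1 i) //= !mxE !eqxx mul1r mulr1.
rewrite big1 ?addr0 => [|k ki]; last by rewrite mxE (negbTE ki) !mul0r.
rewrite big1 ?addr0 // => k kj; apply: big1 => k' _.
by rewrite [evec j _ _]mxE (negbTE kj) mulr0.
Qed.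

Lemma mulmx_mutE f k B : f *m (mutE k B)^T = Emap k (bcol B k) f.
Proof.
apply/rowP => i; rewrite !mxE.
case: eqP => [->|ik].
  rewrite (bigD1 k) //= !mxE !eqxx mulrN1 big1 ?addr0 // => j jk.
  by rewrite !mxE (negbTE jk) eq_sym (negbTE jk) mulr0.
move/eqP: ik => ik; have ki : k != i by rewrite eq_sym.
rewrite (bigD1 k) //= (bigD1 i) //= !mxE eqxx (negbTE ik) eqxx mulr1.
rewrite addrCA big1 ?addr0 // => j /andP[jk ji].
by rewrite !mxE (negbTE jk) eq_sym (negbTE ji) mulr0.
Qed.

Lemma bform_mutE Lam k B f g :
  bform ((mutE k B)^T *m Lam *m mutE k B) f g =
  bform Lam (Emap k (bcol B k) f) (Emap k (bcol B k) g).
Proof. by rewrite /bform -!mulmx_mutE trmx_mul trmxK !mulmxA. Qed.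

Lemma vnegN (b : 'rV[int]_n) : - vneg b = vpos (- b).
Proof. by apply/rowP => i; rewrite !mxE oppr_min oppr0. Qed.

End Bform.

Section ToricFrames.
Variables (F : unitRingType) (q : F) (l n : nat) (ex : {set 'I_n}).
Hypothesis q_central : forall x : F, q * x = x * q.
Hypothesis q_prim : l.-primitive_root q.
Implicit Types (M : 'rV[int]_n -> F) (B Lam : 'M[int]_n) (f g h : 'rV[int]_n).

Let l_gt0 : (0 < l)%N := prim_order_gt0 q_prim.
Let ql : q ^+ l = 1 := prim_expr_order q_prim.
Let q_unit := root_unit l_gt0 ql.

Lemma root_exprz_dvd (m : int) : (l%:Z %| m)%Z -> q ^ m = 1.
Proof. by case/dvdzP => c ->; rewrite mulrC -exprz_exp -exprnP ql exp1rz. Qed.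

Lemma root_exprz_mod (a b : int) : (a = b %[mod l%:Z])%Z -> q ^ a = q ^ b.
Proof.
move=> /eqP; rewrite eqz_mod_dvd => /root_exprz_dvd h.
by rewrite -(subrK b a) exprzDr // h mul1r.
Qed.

(** Primitivity of the root turns an equality of powers back into a congruence, as needed to show
    that an integer matrix is skew-symmetric modulo [l]. *)
Lemma dvd_root_exprz (m : int) : q ^ m = 1 -> (l%:Z %| m)%Z.
Proof.
have e := divz_eq m l%:Z.
have h1 : 0 <= (m %% l%:Z)%Z by apply: modz_ge0; lia.
have h2 : (m %% l%:Z)%Z < l%:Z by apply: ltz_pmod; lia.
rewrite {1}e exprzDr // root_exprz_dvd ?dvdz_mull // mul1r.
rewrite -[in q ^ _](gez0_abs h1) -exprnP => /eqP.
rewrite -(prim_order_dvd q_prim) => h3.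
by rewrite e rpredD ?dvdz_mull // -(gez0_abs h1) dvdzE.
Qed.

Lemma bform_bicharacter Lam : skew_mod l Lam -> bicharacter q (fun f g => q ^ bform Lam f g).
Proof.
move=> hL; split=> [f g h|f g h|f g|f g].
- by rewrite bformDl exprzDr.
- by rewrite bformDr exprzDr.
- rewrite -exprzDr // root_exprz_dvd // (bformE Lam g f) exchange_big bformE -big_split /=.
  apply: rpred_sum => i _; rewrite -big_split /=; apply: rpred_sum => j _.
  have -> : f 0 j * Lam j i * g 0 i + g 0 i * Lam i j * f 0 j =
     (f 0 j * g 0 i) * (Lam j i - - Lam i j) by ring.
  by apply: dvdz_mull; rewrite -eqz_mod_dvd; apply/eqP.
- by have [a _ ->] := root_exprz l_gt0 ql (bform Lam f g); exists a.
Qed.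

Lemma toric_frame_law M Lam : toric_frame q l M Lam ->
  torus_law q M (fun f g => q ^ bform Lam f g).
Proof. by case=> h1 h2 h3 _ _; split => //; apply: bform_bicharacter. Qed.

(** Each mutation comes with its own existentially quantified matrix; uniqueness of the form
    identifies it with the form carried along the sequence. *)
Lemma torus_chi_unique M chi chi' : torus_law q M chi -> torus_law q M chi' ->
  forall f g, chi f g = chi' f g.
Proof.
move=> h h' f g; apply: (mulIr (torus_unit q_central h (f + g))).
by rewrite -(lawM h) -(lawM h').
Qed.

Lemma l_compatible_compatible Lam B : l_compatible l ex Lam B ->
  exists d, compatible q ex (fun f g => q ^ bform Lam f g) B d.
Proof.
case=> d [h1 h2 h3]; exists d; split => // j g jex; apply: root_exprz_mod.
apply/eqP; rewrite eqz_mod_dvd.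
have -> : d j * g 0 j = \sum_i (i == j)%:Z * d j * g 0 i.
  by rewrite (bigD1 j) //= eqxx mul1r big1 ?addr0 // => i /negbTE ->; rewrite !mul0r.
rewrite bformE -sumrB; apply: rpred_sum => i _.
rewrite -mulr_suml -mulrBl; apply: dvdz_mulr; rewrite -eqz_mod_dvd; apply/eqP.
rewrite -(h3 i j jex); congr (_ %% _)%Z; apply: eq_bigr => k _; by rewrite mxE.
Qed.

(** Mutating back uses the column [- b], whereas [Emap k b] is its own inverse. The composite of the
    two maps is therefore not the identity but [h |-> h + b *~ h 0 k], a transvection that preserves
    [chi]. *)
Lemma mut_chi_involutive k chi (b : 'rV[int]_n) (d : int) :
  bicharacter q chi -> b 0 k = 0 -> (forall g, chi b g = q ^ (d * g 0 k)) ->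
  forall f g, mut_chi k (mut_chi k chi b) (- b) f g = chi f g.
Proof.
move=> hchi bk chib f g.
have EE h : Emap k b (Emap k (- b) h) = h + b *~ h 0 k.
  apply/rowP => i; rewrite [RHS]mxE mxzE !mxE eqxx.
  case: eqP => [->|_]; first by rewrite bk; ring.
  by rewrite opprK ![Num.max 0 _]maxC (max0_sub (b 0 i)); ring.
have bN m h : chi h (b *~ m) = q ^ (- (d * h 0 k * m)).
  by rewrite -(chiV hchi) (chi_mulz hchi) chib exprz_exp invr_expz.
rewrite /mut_chi !EE
  (chiDl hchi) !(chiDr hchi) !(chi_mulz hchi) !chib !bN !exprz_exp -!mulrA -!exprzDr //.
rewrite -[RHS]mulr1; congr (_ * _); rewrite -[RHS](expr0z q); congr (q ^ _).
by rewrite mxzE bk; ring.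
Qed.

Lemma mutation_sym k M B M' B' chi d :
  torus_law q M chi -> compatible q ex chi B d -> mutation q l ex k M B M' B' ->
  [/\ mutation q l ex k M' B' M B, torus_law q M' (mut_chi k chi (bcol B k)) &
      compatible q ex (mut_chi k chi (bcol B k)) B' d].
Proof.
move=> hM hB [kex -> [Lam [tM tM' hj hk]]].
have hchi := law_chi hM.
set b := bcol B k.
have bk : b 0 k = 0 by rewrite mxE (compat_diag hB).
have chib g : chi b g = q ^ (d k * g 0 k) := compat_chi hB g kex.
have hMLam := toric_frame_law tM.
have chiE := torus_chi_unique hM hMLam.
have hM' : torus_law q M' (mut_chi k chi b).
  have [h1 h2 h3] := toric_frame_law tM'; split => //; first exact: (mut_chi_bichar k hM b).
  by move=> f g; rewrite h3 bform_mutE /mut_chi chiE.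
have hB' : compatible q ex (mut_chi k chi b) (mutB k B) d by apply:
  (compatible_mutB hB hchi kex l_gt0 ql).
split => //; split => //; first by rewrite mutB_involutive.
exists ((mutE k B)^T *m Lam *m mutE k B); split => //; last 2 first.
- by move=> j jk; rewrite hj.
- have e : bcol (mutB k B) k = - b := bcol_mutB_k k B.
  rewrite vnegN e opprK addrC ![- evec k + _]addrC.
  apply: (mutation_involutive q_central hM bk chib hM' hj).
  by rewrite hk vnegN ![- evec k + _]addrC.
(* The twice conjugated matrix may differ from [Lam], but it yields the same powers of [q], and the
   frame conditions only depend on these. *)
have lawE f g : q ^ bform ((mutE k (mutB k B))^T *m ((mutE k B)^T *m Lam *m mutE k B) *m mutE k
  (mutB k B)) f g
    = chi f g.
  rewrite !bform_mutE bcol_mutB_k -[RHS](mut_chi_involutive hchi bk chib) /mut_chi.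
  by rewrite chiE.
have [t1 t2 t3 t4 t5] := tM.
split => //; last by move=> f g; rewrite lawE (lawM hM).
move=> i j; apply/eqP; rewrite eqz_mod_dvd opprK; apply: dvd_root_exprz.
rewrite exprzDr //; set L := _ *m mutE k (mutB k B).
by rewrite -(bform_evec L i j) -(bform_evec L j i) !lawE (chi_skew hchi).
Qed.

Lemma mut_equiv_trans M B M1 B1 M2 B2 :
  mut_equiv q l ex M B M1 B1 -> mut_equiv q l ex M1 B1 M2 B2 -> mut_equiv q l ex M B M2 B2.
Proof.
move=> h h2; elim: h2 => {M2 B2} [//|k M2 B2 M3 B3 _ IH hm].
exact: mut_equiv_step IH hm.
Qed.

Definition compatible_frame M B :=
  exists chi d, [/\ torus_law q M chi, compatible q ex chi B d & independent q M].

Lemma mut_equiv_sym M B M' B' : compatible_frame M B -> mut_equiv q l ex M B M' B' ->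
  mut_equiv q l ex M' B' M B /\ compatible_frame M' B'.
Proof.
move=> hMB; elim=> {M' B'} [|k M1 B1 M2 B2 _ [IH [chi [d [hM1 hB1 _]]]] hm].
  by split => //; apply: mut_equiv_refl.
have [hm' hM2 hB2] := mutation_sym hM1 hB1 hm; split.
  apply: mut_equiv_trans IH; apply: (mut_equiv_step (mut_equiv_refl _ _ _ _ _) hm').
exists (mut_chi k chi (bcol B1 k)), d; split => //.
by case: hm => _ _ [Lam [_ [_ _ _ h _] _ _]].
Qed.

Lemma mut_equiv_frozen M B M' B' j : j \notin ex -> mut_equiv q l ex M B M' B' ->
  M' (evec j) = M (evec j).
Proof.
move=> jex; elim=> {M' B'} [//|k M1 B1 M2 B2 _ IH [kex _ [Lam [_ _ hj _]]]].
by rewrite hj ?IH //; apply: contraNneq jex => ->.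
Qed.

End ToricFrames.

(** * Laurent phenomenon *)

Section FrozenPositivity.
Variables (K : unitRingType) (q : K) (n : nat) (ex : {set 'I_n}).
Hypothesis q_central : forall x : K, q * x = x * q.
Variables (M : 'rV[int]_n -> K) (chi : 'rV[int]_n -> 'rV[int]_n -> K) (B : 'M[int]_n).
Hypothesis hM : torus_law q M chi.
Hypothesis indM : independent q M.

Lemma tspan_meet (P Q : pred 'rV[int]_n) x : tspan q M P x -> tspan q M Q x ->
  tspan q M (predI P Q) x.
Proof.
move=> hP hQ; have [y [z [hy hz e]]] := tspan_split q_central Q hP.
suff z0 : z = 0 by rewrite e z0 addr0.
apply: (tspan_disjoint indM (P := predI P (predC Q)) (Q := Q)) => //.
  by move=> f /andP[].
have -> : z = x - y by rewrite e addrC addKr.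
apply: tspanB => //; apply: tspan_sub hy => f /andP[] //.
Qed.

Lemma local_alg_frozen r x : r \notin ex -> local_alg q ex M B r x ->
  tspan q M (fun f => 0 <= f 0 r) x.
Proof.
move=> rex; elim=> {x} [x [[f hf ->]|[rex' _]]|||x _|x y _ hx _ hy|x y _ hx _ hy].
- exact: tspan_gen.
- by rewrite rex' in rex.
- by rewrite -(law0 hM); apply: tspan_gen; rewrite mxE.
- suff : tspan q M (fun f => 0 <= f 0 r) (q * M 0) by rewrite (law0 hM) mulr1.
  by apply: tspanZ (Zqq q) _ => //; apply: tspan_gen; rewrite mxE.
- exact: tspanN.
- exact: tspanD.
- by apply: (tspanM q_central hM _ hx hy) => f g hf hg; rewrite mxE addr_ge0.
Qed.

Lemma upper_bound_frozen x (j : 'I_n) : upper_bound q ex M B x ->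
  tspan q M (fun f => [forall (r | r \notin ex), 0 <= f 0 r]) x.
Proof.
move=> hx.
have h (s : seq 'I_n) : tspan q M (fun f => all (fun r => (r \notin ex) ==> (0 <= f 0 r)) s) x.
  elim: s => [|r s IH] /=; first exact: (local_alg_torus q_central hM (hx j)).
  apply: (tspan_meet (P := fun f => (r \notin ex) ==> (0 <= f 0 r))) IH.
  case: (boolP (r \in ex)) => rex /=; first exact: (local_alg_torus q_central hM (hx j)).
  exact: local_alg_frozen (hx r).
apply: tspan_sub (h (enum 'I_n)) => f /allP hf; apply/forall_inP => r rex.
by have := hf r (mem_enum _ _); rewrite rex.
Qed.

End FrozenPositivity.

(** * Lifting mutation sequences to principal coefficients *)

Section Lift.
Variables (F : unitRingType) (q : F) (l n : nat) (ex : {set 'I_n}).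
Hypothesis q_central : forall x : F, q * x = x * q.
Hypothesis q_prim : l.-primitive_root q.
Variables (M : 'rV[int]_n -> F) (chi : 'rV[int]_n -> 'rV[int]_n ->
  F) (B : 'M[int]_n) (d : 'I_n -> int).
Hypothesis hM : torus_law q M chi.
Hypothesis hB : compatible q ex chi B d.
Variables (K : unitRingType) (q' : K) (M' : 'rV[int]_(n + n) -> K).
Variables (chi' : 'rV[int]_(n + n) -> 'rV[int]_(n + n) -> K) (S : K -> F -> Prop).
Hypothesis hE : extension q M chi (fun f : 'rV[int]_(n + n) => rsubmx f) q' M' chi' S.

Let l_gt0 : (0 < l)%N := prim_order_gt0 q_prim.
Let ql : q ^+ l = 1 := prim_expr_order q_prim.
Let q'_central := ext_central hE.
Let q'l : q' ^+ l = 1. Proof. exact: (ext_exp hE (m := l%:Z)). Qed.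
Let K_div := ext_div hE.

(* Principal coefficients; the first [n] coordinates are the adjoined frozen ones. *)
Definition principal_mx : 'M[int]_(n + n) := block_mx 0 1%:M 0 B.
Definition principal_ex : {set 'I_(n + n)} := [set rshift n i | i in ex].
Definition principal_d (j : 'I_(n + n)) : int := if split j is inr i then d i else 1.

Let split_r (i : 'I_n) : split (rshift n i) = inr i :> 'I_n + 'I_n.
Proof. exact: (unsplitK (inr i)). Qed.

Lemma principal_seed : generic_seed q' principal_ex M' chi' principal_mx principal_d.
Proof.
split; [exact: (ext_law hE)|exact: (ext_indep hE)|split|].
- by move=> _ /imsetP[j jex ->]; rewrite /principal_d split_r; apply: (compat_pos hB).
- move=> _ _ /imsetP[i iex ->] /imsetP[j jex ->].
  by rewrite /principal_d !split_r /principal_mx !block_mxEdr (compat_skew hB).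
- move=> _ g /imsetP[j jex ->]; rewrite /principal_d split_r.
  apply: (ext_chi_pow hE).
  have -> : rsubmx (bcol principal_mx (rshift n j)) = bcol B j.
    by apply/rowP => i; rewrite mxE mxE [RHS]mxE /principal_mx block_mxEdr.
  by rewrite (compat_chi hB) // mxE.
(* The identity block of [principal_mx]: the adjoined coordinate of index [i'] is dual to the column
   of [i']. *)
exists (fun i (f : 'rV[int]_(n + n)) => if split i is inr i' then f 0 (lshift n i') else 0); split.
  by move=> i f g; case: (split i) => i'; rewrite ?addr0 // mxE.
move=> _ _ /imsetP[i iex ->] /imsetP[j jex ->].
by rewrite split_r mxE /principal_mx block_mxEur mxE (inj_eq (@rshift_inj _ _)); case: eqP.
Qed.

Lemma rsub_evec_r (i : 'I_n) : rsubmx (evec (rshift n i)) = evec i.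
Proof. by apply/rowP => j; rewrite !mxE (inj_eq (@rshift_inj _ _)). Qed.

Lemma rsub_evec_l (i : 'I_n) : rsubmx (evec (lshift n i)) = 0.
Proof. by apply/rowP => j; rewrite !mxE eq_rlshift. Qed.

Lemma S_Zq c : in_Zq q' c -> exists2 a, in_Zq q a & S c a.
Proof.
have S0 : S 0 0 by rewrite -(subrr 1) -[X in S _ X](subrr 1); apply: (extD hE (ext1 hE));
  apply: (extN hE (ext1 hE)).
have Sn (m : nat) : S m%:R m%:R.
  by elim: m => [//|m IH]; rewrite -!natr1; apply: (extD hE IH (ext1 hE)).
have Sz (m : int) : S m%:~R m%:~R.
  by case: m => m; [apply: Sn|rewrite NegzE !mulrNz; apply: (extN hE); apply: Sn].
have SX (m : nat) : S (q' ^+ m) (q ^+ m).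
  by elim: m => [|m IH]; [apply: (ext1 hE)|rewrite !exprS; apply: (extM hE (extq hE) IH)].
case=> m [a ->]; exists (\sum_(i < m) (a i)%:~R * q ^+ i); first by exists m, a.
apply: (big_ind2 S) => //; first by move=> ? ? ? ? h1 h2; apply: (extD hE h1 h2).
by move=> i _; apply: (extM hE).
Qed.

Lemma S_span (P : pred 'rV[int]_(n + n)) G x : (forall f, P f -> gen_alg q G (M (rsubmx f))) ->
  tspan q' M' P x -> exists2 z, S x z & gen_alg q G z.
Proof.
move=> hG; apply: (tspan_ind (T := fun x => exists2 z, S x z & gen_alg q G z)).
- exists 0; last exact: gen_alg0.
  by rewrite -(subrr 1) -[X in S _ X](subrr 1); apply: (extD hE (ext1 hE));
    apply: (extN hE (ext1 hE)).
- move=> y z [a ha ga] [b hb gb]; exists (a + b); first exact: (extD hE).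
  exact: gen_add.
- move=> c f /S_Zq[a ha hca] Pf; exists (a * M (rsubmx f)).
    exact: (extM hE hca (ext_frame hE f)).
  by apply: gen_mul; [apply: gen_alg_Zq|apply: hG].
Qed.

(** The invariant along a mutation sequence. [S] need not be closed under inverses, so
    specialization is asserted for cluster variables only; [lifted_nonneg] extends it to nonnegative
    exponents. An adjoined variable specializes to [M1 0], that is, to 1. *)
Record lifted (M1 : 'rV[int]_n -> F) (B1 : 'M[int]_n) chi1 (M1' : 'rV[int]_(n + n) ->
  K) B1' chi1' : Prop := Lifted {
  lift_law : torus_law q M1 chi1;
  lift_seed : generic_seed q' principal_ex M1' chi1' B1' principal_d;
  lift_mx : forall i j, B1' (rshift n i) (rshift n j) = B1 i j;
  lift_chi : forall f g, S (chi1' f g) (chi1 (rsubmx f) (rsubmx g));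
  lift_upper : forall x, upper_bound q' principal_ex M1' B1' x ->
    upper_bound q' principal_ex M' principal_mx x;
  lift_evec : forall i, S (M1' (evec i)) (M1 (rsubmx (evec i))) }.

Lemma lifted_nonneg M1 B1 chi1 M1' B1' chi1' : lifted M1 B1 chi1 M1' B1' chi1' ->
  forall f : 'rV[int]_(n + n), (forall i, 0 <= f 0 i) -> S (M1' f) (M1 (rsubmx f)).
Proof.
move=> h f hf; have hM1' := gs_law (lift_seed h).
have good0 : S (M1' 0) (M1 (rsubmx (0 : 'rV[int]_(n + n)))).
  by rewrite (law0 hM1') raddf0 (law0 (lift_law h)); apply: (ext1 hE).
have goodD u v : S (M1' u) (M1 (rsubmx u)) -> S (M1' v) (M1 (rsubmx v)) ->
   S (M1' (u + v)) (M1 (rsubmx (u + v))).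
  move=> hu hv; rewrite (torusD hM1') raddfD (torusD (lift_law h)).
  by apply: (extM hE (lift_chi h _ _)); apply: (extM hE).
rewrite (row_evec f).
apply: (big_ind (fun u => S (M1' u) (M1 (rsubmx u)))) => // i _.
rewrite -[f 0 i]gez0_abs //; move: `|(f 0 i)%R|%N => a.
elim: a => [|a IH]; first by rewrite mulr0z.
by rewrite -pmulrn mulrS; apply: goodD => //; apply: (lift_evec h i).
Qed.

Lemma lifted_base : lifted M B chi M' principal_mx chi'.
Proof.
split => //; first exact: principal_seed.
- by move=> i j; rewrite /principal_mx block_mxEdr.
- exact: (ext_chi hE).
- by move=> i; apply: (ext_frame hE).
Qed.

Lemma lifted_step k M1 B1 chi1 M1' B1' chi1' M2 B2 :
  lifted M1 B1 chi1 M1' B1' chi1' -> mutation q l ex k M1 B1 M2 B2 ->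
  exists chi2 M2' B2' chi2', lifted M2 B2 chi2 M2' B2' chi2'.
Proof.
move=> h [kex -> [Lam [tM1 tM2 hj hk]]].
have hM1 := lift_law h.
pose k' := rshift n k : 'I_(n + n).
have k'ex : k' \in principal_ex by apply: imset_f.
have hS1 := lift_seed h.
have hS2 := mut_seed_generic q'_central l_gt0 q'l K_div k'ex hS1.
pose b := bcol B1 k; pose b' := bcol B1' k'.
have rb : rsubmx b' = b by apply/rowP => i; rewrite !mxE (lift_mx h).
have rbN : rsubmx (- b') = - b by rewrite -rb; apply/rowP => i; rewrite !mxE.
have rE f : rsubmx (Emap k' b' f) = Emap k b (rsubmx f).
  by rewrite -rb; apply/rowP => i; rewrite !mxE (inj_eq (@rshift_inj _ _)).
exists (mut_chi k chi1 b), (mut_seed q' M1' B1' principal_d k'), (mutB k' B1'),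
  (mut_chi k' chi1' b').
have hM2 : torus_law q M2 (mut_chi k chi1 b).
  have [h1 h2 h3] := toric_frame_law q_prim tM2; split => //; first exact: (mut_chi_bichar k hM1 b).
  move=> f g; rewrite h3 bform_mutE /mut_chi.
  by rewrite (torus_chi_unique q_central hM1 (toric_frame_law q_prim tM1)).
have hup x : upper_bound q' principal_ex (mut_seed q' M1' B1' principal_d k') (mutB k' B1') x ->
    upper_bound q' principal_ex M' principal_mx x.
  move=> hx; apply: (lift_upper h).
  exact: (upper_bound_mut q'_central l_gt0 q'l K_div k'ex hS1 hx).
split => //.
- move=> i j; rewrite !mxE !(inj_eq (@rshift_inj _ _)) !(lift_mx h).
  by [].
- by move=> f g; rewrite /mut_chi -!rE; apply: (lift_chi h).
move=> i; case: (eqVneq i k') => [->|ik]; last first.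
  rewrite mut_seed_id; last by rewrite mxE eq_sym (negbTE ik).
  have -> : M2 (rsubmx (evec i)) = M1 (rsubmx (evec i)).
    case: (split_ordP i) => j ij; rewrite ij ?rsub_evec_l ?rsub_evec_r.
      by rewrite (law0 hM1) (law0 hM2).
    by apply: hj; apply: contraNneq ik => e; rewrite ij e.
  exact: (lift_evec h).
(* The formula for the new variable contains the inverse of an old one, to which [S] need not apply.
   But the new variable lies in the initial upper bound, hence is a Laurent polynomial in the
   initial frame, and so specializes to some [z]. *)
have [z hz _] : exists2 z,
  S (mut_seed q' M1' B1' principal_d k' (evec k')) z & gen_alg q (fun=> True) z.
  apply: (S_span (P := predT)) => [f _|]; first exact: gen_S.
  apply: (local_alg_torus q'_central (ext_law hE) (ex := principal_ex) (r := k') (B :=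
    principal_mx)).
  by apply: hup; apply: upper_bound_cluster.
suff <- : z = M2 (rsubmx (evec k')) by [].
rewrite rsub_evec_r.
(* Multiplying the exchange relation by the old variable clears its inverse. Both sides then involve
   nonnegative exponents only, whose specializations are known, and single-valuedness of [S]
   determines [z]. *)
apply: (mulIr (torus_unit q_central hM1 (evec k))).
have Sek := lift_evec h k'; rewrite rsub_evec_r in Sek.
apply: (ext_fun hE (extM hE hz Sek)).
have hM1' := gs_law hS1.
rewrite (mut_seed_i q'_central l_gt0 q'l k'ex hS1) hk vnegN ![- evec k + _]addrC.
rewrite /exchange_elt !mulrDl.
have term (v : 'rV[int]_(n + n)) : (forall i, 0 <= v 0 i) ->
    S (M1' (v - evec k') * M1' (evec k')) (M1 (rsubmx v - evec k) * M1 (evec k)).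
  move=> hv; rewrite !(lawM hM1') !(lawM hM1) !subrK.
  apply: (extM hE); last exact: (lifted_nonneg h).
  by rewrite -(rsub_evec_r k) -raddfB; apply: (lift_chi h).
have vr (w : 'rV[int]_(n + n)) : rsubmx (vpos w) = vpos (rsubmx w).
  by apply/rowP => i'; rewrite !mxE.
have vge (w : 'rV[int]_(n + n)) i' : 0 <= (vpos w) 0 i' by rewrite mxE le_max lexx orbT.
apply: (extD hE).
  by have := term (vpos b') (vge _); rewrite vr rb.
by have := term (vpos (- b')) (vge _); rewrite vr rbN.
Qed.

Lemma mut_equiv_lifted M1 B1 : mut_equiv q l ex M B M1 B1 ->
  exists chi1 M1' B1' chi1', lifted M1 B1 chi1 M1' B1' chi1'.
Proof.
elim=> {M1 B1} [|k M1 B1 M2 B2 _ [chi1 [M1' [B1' [chi1' h]]]] hm].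
  by exists chi, M', principal_mx, chi'; apply: lifted_base.
exact: lifted_step h hm.
Qed.

Definition laurent_gen (y : F) : Prop :=
  (exists i, y = M (evec i)) \/ (exists j, j \in ex /\ y = (M (evec j))^-1).

Lemma laurent_monomial (f : 'rV[int]_n) : (forall r, r \notin ex -> 0 <= f 0 r) ->
  gen_alg q laurent_gen (M f).
Proof.
move=> hf.
have goodD u v : gen_alg q laurent_gen (M u) -> gen_alg q laurent_gen (M v) ->
  gen_alg q laurent_gen (M (u + v)).
  move=> hu hv; rewrite (torusD hM); apply: gen_mul; last exact: gen_mul.
  by apply: gen_alg_Zq; apply: (chi_Zq q_central (law_chi hM)).
have good0 : gen_alg q laurent_gen (M 0) by rewrite (law0 hM); apply: gen_1.
have goodn u (a : nat) : gen_alg q laurent_gen (M u) -> gen_alg q laurent_gen (M (u *+ a)).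
  by move=> hu; elim: a => [//|a IH]; rewrite mulrS; apply: goodD.
rewrite (row_evec f); apply: (big_ind (fun u => gen_alg q laurent_gen (M u))) => // i _.
have gi : gen_alg q laurent_gen (M (evec i)) by apply: gen_S; left; exists i.
case: (boolP (i \in ex)) => hi; last first.
  by rewrite -[f 0 i]gez0_abs ?hf // -pmulrn; apply: goodn.
case: (f 0 i) => a; first exact: goodn.
rewrite NegzE mulrNz -pmulrn -mulNrn; apply: goodn; rewrite (torusN q_central hM).
apply: gen_mul; first by apply: gen_alg_Zq; apply: (chi_Zq q_central (law_chi hM)).
by apply: gen_S; right; exists i.
Qed.

Lemma laurent_phenomenon M1 B1 i : mut_equiv q l ex M B M1 B1 ->
  gen_alg q laurent_gen (M1 (evec i)).
Proof.
move=> /mut_equiv_lifted[chi1 [M1' [B1' [chi1' h]]]].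
have hx := lift_upper h (upper_bound_cluster q' principal_ex M1' B1' (rshift n i)).
have := upper_bound_frozen q'_central (ext_law hE) (ext_indep hE) (rshift n i) hx.
case/(S_span (G := laurent_gen)) => [f /forall_inP hf|z hz hG].
  apply: laurent_monomial => r rex; rewrite mxE; apply: hf.
  by apply: contra rex => /imsetP[j jex /rshift_inj ->].
have := lift_evec h (rshift n i); rewrite rsub_evec_r => hz'.
by rewrite (ext_fun hE hz' hz).
Qed.

End Lift.

(** * Passage to an arbitrary base seed *)

Theorem theorem3p10
  (l : nat) (hl : (0 < l)%N)
  (F : unitRingType)
  (F_div : forall x : F, x != 0 -> x \is a GRing.unit)
  (F_char0 : forall n : nat, (n.+1)%:R != 0 :> F)
  (q : F) (q_prim : l.-primitive_root q) (q_central : forall x : F, q * x = x * q)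
  (N : nat) (ex inv : {set 'I_N}) (inv_ex : inv \subset ~: ex)
  (M : 'rV[int]_N -> F) (B : 'M[int]_N)
  (seed : quantum_seed q l ex M B) :
  forall x : F, cluster_alg q l ex inv M B x -> upper_cluster_alg q l ex inv M B x.
Proof.
have [Lam [tM cM]] := seed.
have hMB : compatible_frame q ex M B.
  have [d hd] := l_compatible_compatible q_prim cM.
  exists (fun f g => q ^ bform Lam f g), d; split => //; first exact: (toric_frame_law q_prim tM).
  by case: tM.
move=> x hx M2 B2 h2; move: x hx; apply: gen_alg_sub => x.
(* The seed [M2] of the intersection becomes the base: reversing the path from [M] to [M2] and then
   following the path to [M1] makes [M1] mutation-equivalent to [M2]. *)
have [h2' [chi [d [hM2 hB2 indM2]]]] := mut_equiv_sym q_central q_prim hMB h2.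
case=> [[M1 [B1 [i [h1 ->]]]]|[j [jinv ->]]]; last first.
  apply: gen_S; right; exists j; rewrite inE jinv orbT; split => //.
  (* Frozen variables are common to all seeds, so the adjoined inverses are already inverses of
     variables of [M2]. *)
  have jex : j \notin ex by have := fintype.subsetP inv_ex j jinv; rewrite inE.
  by rewrite (mut_equiv_frozen jex h2).
have [K [q' [M' [chi' [S hE]]]]] :=
  adjoin_many N F_div F_char0 q_central hl (prim_expr_order q_prim) hM2 indM2.
have h := mut_equiv_trans h2' h1.
apply: gen_alg_sub (laurent_phenomenon q_central q_prim hM2 hB2 hE i h).
move=> y [[i' ->]|[j [jex ->]]]; apply: gen_S; [by left; exists i'|right].
by exists j; rewrite inE jex.
Qed.
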